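(* Let $\mathcal Y=\mathcal X\subseteq\mathbb R^d$ be Borel and consider the distortion function $\rho=\omega^k|_{\mathcal X\times\mathcal X}$, where $k\in(0,\infty)$ and $\omega$ is a metric on $\mathbb R^d$. Suppose that the random variable $X$ takes values in $\mathcal X$, with distribution $\mu_X$, and assume that there exists a finite measure $\nu$ on $\mathcal X$, normalized according to $\nu(\mathcal X)=1$, with $\nu\ll\mu_X$ and $$\left\|\frac{\mathrm d\nu}{\mathrm d\mu_X}\right\|_\infty^{(\mu_X)}<\infty.$$ Further, let $\nu$ be $\rho^{1/k}$-superregular of dimension $m\in(k,\infty)$ with superregularity constants $b\in(0,\infty)$ and $\delta_0\in(0,\infty]$, and assume that $$\sup_{x,y\in\mathcal X}\omega(x,y)<\infty\quad\text{if }\delta_0<\infty.$$ Then $$\limsup_{n\to\infty}n^{\frac km}V_n(X)\le\Omega_{k/m}(X)\,\Gamma\left(1+\frac km\right)b^{-\frac km},$$ where $$\Omega_\alpha(X)=\mathbb E\left[\left(\frac{\mathrm d\nu}{\mathrm d\mu_X}(X)\right)^\alpha\right]\le1\quad\text{for all }\alpha\in(0,1),$$ with strict inequality $\Omega_\alpha(X)<1$ unless $\mu_X=\nu$. If, in addition, $D_k(X)=m$ (i.e., the $k$-th quantization dimension exists and equals $m$), then $$\overline C_k(X)\le\Omega_{k/m}(X)\,\Gamma\left(1+\frac km\right)b^{-\frac km}.$$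
   Context: All measures are positive; $\mathcal X$ carries its Borel $\sigma$-algebra and measures on it are Borel measures. A distortion function $\rho\colon\mathcal X\times\mathcal Y\to[0,\infty]$ is a function measurable with respect to the product $\sigma$-algebra. $\log$ is the natural logarithm. For a distortion function $\varrho$ on $\mathcal X\times\mathcal Y$, a measure $\nu$ on $\mathcal Y$ is $\varrho$-superregular of dimension $m\in[0,\infty)$ with superregularity constants $b\in(0,\infty)$ and $\delta_0\in(0,\infty]$ if $\nu(\{y\in\mathcal Y:\varrho(x,y)<\delta\})\ge b\,\delta^m$ for all $x\in\mathcal X$ and $\delta\in(0,\delta_0)$. $\|f\|_\infty^{(\mu)}$ is the $\mu$-essential supremum of $|f|$. $n$-th quantization error: $V_n(X)=\inf_{f}\mathbb E[\rho(X,f(X))]$ over all measurable $f\colon\mathcal X\to\mathcal Y$ with $|f(\mathcal X)|\le n$. Lower and upper $k$-th quantization dimensions: $$\underline D_k(X)=\liminf_{n\to\infty}\frac{k\log n}{\log(1/V_n(X))},\qquad\overline D_k(X)=\limsup_{n\to\infty}\frac{k\log n}{\log(1/V_n(X))}.$$ Conventions: the quotient is $0$ if $V_n(X)=0$; if $\lim_{n\to\infty}V_n(X)>0$, then $\underline D_k(X)=\overline D_k(X)=\infty$. If $\underline D_k(X)=\overline D_k(X)$, the common value is denoted $D_k(X)$. If $D_k(X)$ exists in $(0,\infty)$, the upper $k$-th quantization coefficient is $\overline C_k(X)=\limsup_{n\to\infty}n^{k/D_k(X)}V_n(X)$. *)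

(* Defs.v *)
From HB Require Import structures.
From mathcomp Require Import all_boot all_order all_algebra.
From mathcomp Require Import all_classical all_reals all_analysis.
From mathcomp Require Import measurable_realfun ess_sup_inf random_variable.
Set Implicit Arguments.
Unset Strict Implicit.
Unset Printing Implicit Defensive.
Import Order.TTheory GRing.Theory Num.Theory.
Import numFieldNormedType.Exports.
Local Open Scope classical_set_scope.
Local Open Scope ring_scope.

Definition is_metric (R : realType) (E : Type) (omega : E -> E -> R) : Prop :=
  [/\ forall x y, 0 <= omega x y,
      forall x y, omega x y = 0 <-> x = y,
      forall x y, omega x y = omega y x &
      forall x y z, omega x z <= omega x y + omega y z].

(* Measurable types are pointed in the library, hence the nonemptiness proof
   carried by the subspace; a set in which a random variable takes its values
   is never empty. *)
Definition nonempty_subspace (E : topologicalType) (A : set E)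
  (A0 : A !=set0) : Type := set_type A.

Section nonempty_subspace.
Context (E : topologicalType) (A : set E) (A0 : A !=set0).

HB.instance Definition _ := Choice.copy (nonempty_subspace A0) (set_type A).

HB.instance Definition _ := isPointed.Build (nonempty_subspace A0)
  (SigSub (mem_set (projT2 (cid A0))) : set_type A).

End nonempty_subspace.

Definition borel_subspace (E : topologicalType) (A : set E) (A0 : A !=set0) :=
  @g_sigma_algebraType (nonempty_subspace A0) (open : set (set (set_type A))).

Definition borel_subspace_val (E : topologicalType) (A : set E)
  (A0 : A !=set0) (x : borel_subspace A0) : E := set_val (x : set_type A).

Section distortion.
Context (R : realType) (dX dY : measure_display).
Context (TX : measurableType dX) (TY : measurableType dY).
Implicit Type rho : TX -> TY -> \bar R.
Local Open Scope ereal_scope.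

Definition distortion_function rho : Prop :=
  (forall x y, 0 <= rho x y) /\
  measurable_fun [set: TX * TY]
    ((fun xy => rho xy.1 xy.2) : TX * TY -> \bar R).

Definition superregular rho (nu : {measure set TY -> \bar R}) (m b : R)
    (delta0 : \bar R) : Prop :=
  [/\ (0 <= m)%R, (0 < b)%R, 0 < delta0 &
      forall (x : TX) (delta : R), (0 < delta)%R -> delta%:E < delta0 ->
        (b * delta `^ m)%:E <= nu [set y | rho x y < delta%:E]].

Context (dO : measure_display) (O : measurableType dO) (P : probability O R).

Definition quantization_error (X : {RV P >-> TX}) rho (n : nat) : \bar R :=
  ereal_inf [set \int[P]_w rho (X w) (f (X w)) | f in
    [set f : TX -> TY | measurable_fun [set: TX] f /\ (range f #<= `I_n)%card]].

Definition quantization_ratio (X : {RV P >-> TX}) rho (k : R) (n : nat) :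
    \bar R :=
  let V := quantization_error X rho n in
  if V == 0 then 0 else (k * ln n%:R)%:E / lne V^-1.

(* The limit exists: the quantization error is nonincreasing in n. *)
Definition lower_quantization_dimension (X : {RV P >-> TX}) rho (k : R) :
    \bar R :=
  if 0 < limn (quantization_error X rho) then +oo
  else limn_einf (quantization_ratio X rho k).

Definition upper_quantization_dimension (X : {RV P >-> TX}) rho (k : R) :
    \bar R :=
  if 0 < limn (quantization_error X rho) then +oo
  else limn_esup (quantization_ratio X rho k).

Definition has_quantization_dimension (X : {RV P >-> TX}) rho (k : R)
    (D : \bar R) : Prop :=
  lower_quantization_dimension X rho k = D /\
  upper_quantization_dimension X rho k = D.

(* Meaningful when the quantization dimension exists in (0, +oo); it is then
   the upper quantization dimension. *)
Definition upper_quantization_coefficient (X : {RV P >-> TX}) rho (k : R) :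
    \bar R :=
  let D := fine (upper_quantization_dimension X rho k) in
  limn_esup (fun n => (n%:R `^ (k / D))%:E * quantization_error X rho n).

End distortion.

Definition metric_distortion (R : realType) (E : topologicalType) (A : set E)
    (A0 : A !=set0) (omega : E -> E -> R) (k : R)
    (x y : borel_subspace A0) : \bar R :=
  (omega (borel_subspace_val x) (borel_subspace_val y) `^ k)%:E.

(* A version of the derivative, nonnegative only mu-almost everywhere. *)
Definition density (R : realType) (d : measure_display) (T : measurableType d)
    (nu : {finite_measure set T -> \bar R})
    (mu : {sigma_finite_measure set T -> \bar R}) : T -> \bar R :=
  Radon_Nikodym (charge_of_finite_measure nu) mu.

Definition density_moment (R : realType) (d dO : measure_display)
    (T : measurableType d) (O : measurableType dO) (P : probability O R)
    (X : {RV P >-> T}) (nu : {finite_measure set T -> \bar R}) (alpha : R) :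
    \bar R :=
  (\int[P]_w (density nu (distribution P X) (X w) `^ alpha))%E.

Definition Gamma (R : realType) (s : R) : \bar R :=
  (\int[lebesgue_measure]_(t in `]0%R, +oo[) (t `^ (s - 1) * expR (- t))%:E)%E.

(* Main.v *)
Require Import Defs.
From HB Require Import structures.
From mathcomp Require Import all_boot all_order all_algebra.
From mathcomp Require Import all_classical all_reals all_analysis.
From mathcomp Require Import measurable_realfun ess_sup_inf random_variable.
From mathcomp Require Import ring lra.
Set Implicit Arguments.
Unset Strict Implicit.
Unset Printing Implicit Defensive.
Import Order.TTheory GRing.Theory Num.Theory.
Import numFieldNormedType.Exports.
Local Open Scope classical_set_scope.
Local Open Scope ring_scope.
Local Open Scope ereal_scope.

(** The bound is proved by random coding: if code points are drawn independently
with density [w] with respect to the law [mu] of [X], then the expected distortion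
at [x] is the integral over [t > 0] of [miss x t ^ n], where [miss x t] is the
probability that one code point is farther than [t] from [x]. The codebook is
derandomized one point at a time ([derandomized_coding]), so that only a Tonelli
argument is needed ([quantization_error_le_miss]).

Let [h] be the density of [nu] and [alpha = k / m]. If a draw falls in the
[omega]-ball of radius [r] around [x] with probability at least [c * r ^ m] for small
[r], then [miss x t <= exp (- c * t ^ (1 / alpha))] for small [t], and
integrating the [n]-th power gives [n ^ (- alpha) * c ^ (- alpha) * Gamma (1 + alpha)]
up to an exponentially small term ([integral_pow_le_local_decay]). The claim
therefore amounts to drawing with [c] close to [b / h x]. Drawing from [mu] itself
would achieve this wherever [nu B / mu B] tends to [h x] on shrinking balls [B]
around [x], but this differentiation property can fail for an arbitrary metric and
an arbitrary measure.

Instead, draw from a multiple of [nu / g], where [g] is slightly larger than [h]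
outside a small exceptional set and almost locally constant for [omega]. Cut [h]
into levels of height [eps]. Outside a set of [mu]-measure as small as desired,
distinct levels are separated by a positive [omega]-gap ([level_gap]). Let [g] be
the upper end of the level of [h] on this large set [K], and let [g = eps] off [K].
Near a point [x] of [K], [g] is at most [g x], both at the points of the same level
and at the points off [K], so a ball of radius [r] around [x] is hit with
probability at least [b * r ^ m / ((1 + eps) * g x)]. The factor [1 + eps] bounds
the mass of [nu / g]: this mass is at most [1] on [K], and oversampling the
complement of [K] costs at most [(H / eps) * mu (~` K)], where [H] bounds [h].
Letting [eps] tend to [0] turns [g ^ alpha] into [h ^ alpha]
([limn_esup_quantization_error_le]).

The gap between levels is the only place where the topology of the Euclidean space
enters. The metric [omega] is unrelated to that topology, but its balls are Borel
sets, and superregularity makes [omega] totally bounded, hence separable. By inner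
regularity, the countable family consisting of the balls with dense centres and the
level sets of [h] becomes clopen on a Euclidean compact set of almost full measure
([almost_continuous_family]). On such a set, limits along an ultrafilter respect
[omega] and the levels, whence the gap.

The estimate of the moments of the density is the strict tangent inequality
[x ^ a <= 1 - a + a * x], integrated. *)

(** * Inner regularity by Euclidean compact sets *)

Section inner_regularity.
Context d (T : measurableType d) (R : realType).
Variable mu : {finite_measure set T -> \bar R}.

Lemma measure_bigcup_le_geometric (F : (set T)^nat) (e : R) :
  (0 <= e)%R -> (forall n, measurable (F n)) ->
  (forall n, mu (F n) <= (e / (2 ^ n.+1)%:R)%:E) ->
  mu (\bigcup_n F n) <= e%:E.
Proof.
move=> e0 mF Fe; apply: (le_trans _ (@epsilon_trick0 R e xpredT e0)).
apply: (@le_trans _ _ (\sum_(n <oo) mu (F n))).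
  by apply: measure_sigma_subadditive => //; exact: bigcupT_measurable.
by apply: lee_nneseries => [n|n _]; [rewrite measure_ge0|exact: Fe].
Qed.

Lemma measure_bigcap_small (F : (set T)^nat) (e : R) : (0 < e)%R ->
  (forall n, measurable (F n)) -> nonincreasing_seq F ->
  \bigcap_n F n = set0 -> exists n, mu (F n) < e%:E.
Proof.
move=> e0 mF nF F0.
have Foo : mu (F 0%N) < +oo by rewrite ltey_eq fin_num_measure.
have mF0 : measurable (\bigcap_n F n) by rewrite F0.
have := nonincreasing_cvg_mu Foo mF mF0 nF.
rewrite F0 measure0 => /fine_cvgP[_] /cvgrPdist_lt /(_ e e0)[N _ /(_ N (leqnn N))].
rewrite /= sub0r normrN ger0_norm ?fine_ge0// => FN; exists N.
by rewrite -[mu (F N)]fineK ?fin_num_measure// lte_fin.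
Qed.

Context (E : pseudoMetricNormedZmodType R) (v : T -> E).
Hypothesis mv : forall U : set E, open U -> measurable (v @^-1` U).

Let measurable_preimage_closed (C : set E) : closed C -> measurable (v @^-1` C).
Proof.
move=> cC; rewrite -(setCK C) preimage_setC; apply: measurableC.
exact: (mv (closed_openC cC)).
Qed.

(** The approximation is two-sided in order to be stable under complement, and
closedness and openness are required in [E] rather than in [T]. *)
Definition closed_open_approx (S : set E) := forall e : R, (0 < e)%R ->
  exists C U, [/\ closed C, open U, C `<=` S, S `<=` U &
    mu (v @^-1` (U `\` C)) < e%:E].

Let measurable_gap (C U : set E) : closed C -> open U ->
  measurable (v @^-1` (U `\` C)).
Proof.
by move=> cC oU; apply: measurableD; [exact: mv|exact: measurable_preimage_closed].
Qed.

Lemma open_closed_open_approx (U : set E) : open U -> closed_open_approx U.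
Proof.
move=> oU e e0.
pose V n := \bigcup_(z in ~` U) ball z (n.+1%:R^-1 : R).
have oV n : open (V n) by apply: bigcup_open => z _; exact: ball_open.
have mVU n : measurable (v @^-1` (U `&` V n)) by apply: (mv _); exact: openI.
have nV : nonincreasing_seq (fun n => v @^-1` (U `&` V n)).
  move=> m n mn; apply/subsetPset => x [Ux [z Uz zx]]; split => //; exists z => //.
  by apply: le_ball zx; rewrite lef_pV2 ?posrE// ler_nat.
have V0 : \bigcap_n (v @^-1` (U `&` V n)) = set0.
  apply/seteqP; split => // x Vx; have [Ux _] := Vx 0%N I.
  have /nbhs_ballP[r /= r0 rU] : nbhs (v x) U by exact: open_nbhs_nbhs.
  have [n _ /(_ n (leqnn n)) nr] := near_infty_natSinv_lt (PosNum r0).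
  have [_ [z Uz zx]] := Vx n I; apply: Uz; apply: rU.
  by apply: ball_sym; apply: le_ball zx; exact: ltW.
have [n Vn] := measure_bigcap_small e0 mVU nV V0.
exists (~` V n), U; split => //; first exact: open_closedC.
  move=> x Vx; apply: contrapT => Ux; apply: Vx; exists x => //.
  exact: ballxx.
by rewrite setDE setCK.
Qed.

Lemma closed_open_approxC (S : set E) :
  closed_open_approx S -> closed_open_approx (~` S).
Proof.
move=> aS e e0; have [C [U [cC oU CS SU CUe]]] := aS e e0.
exists (~` U), (~` C); split; [exact: open_closedC|exact: closed_openC|
  exact: subsetC|exact: subsetC|].
by rewrite setDE setCK setIC.
Qed.

(** A countable union of closed sets need not be closed: half of the error is spent
on cutting the union of the inner approximations after finitely many terms. *)
Lemma closed_open_approx_bigcup (S : (set E)^nat) :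
  (forall n, closed_open_approx (S n)) -> closed_open_approx (\bigcup_n S n).
Proof.
move=> aS e e0.
have e20 : (0 < e / 2)%R by rewrite divr_gt0.
have en0 n : (0 < (e / 2) / (2 ^ n.+1)%:R)%R by rewrite divr_gt0// ltr0n expn_gt0.
have /choice[C /choice[U CUP]] : forall n, exists C U, [/\ closed C, open U,
    C `<=` S n, S n `<=` U & mu (v @^-1` (U `\` C)) < ((e / 2) / (2 ^ n.+1)%:R)%:E].
  by move=> n; exact: aS.
have mCU n : measurable (v @^-1` (U n `\` C n)).
  by have [? ? _ _ _] := CUP n; exact: measurable_gap.
have oU : open (\bigcup_n U n) by apply: bigcup_open => n _; have [] := CUP n.
have cC N : closed (\bigcup_(n < N) C n).
  apply: closed_bigcup => [|n _]; [exact: finite_II|by have [] := CUP n].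
have mD N : measurable (v @^-1` (\bigcup_n C n `\` \bigcup_(n < N) C n)).
  apply: measurableD.
    rewrite -[X in measurable X]/(v @^-1` _) preimage_bigcup.
    apply: bigcupT_measurable => n; apply: measurable_preimage_closed.
    by have [] := CUP n.
  exact: measurable_preimage_closed.
have nD : nonincreasing_seq (fun N => v @^-1` (\bigcup_n C n `\` \bigcup_(n < N) C n)).
  move=> m n mn; apply/subsetPset => x [Cx nCx]; split => // -[i /= im Cix].
  by apply: nCx; exists i => //=; exact: leq_trans im mn.
have D0 : \bigcap_N (v @^-1` (\bigcup_n C n `\` \bigcup_(n < N) C n)) = set0.
  apply/seteqP; split => // x Dx; have [[n _ Cnx] _] := Dx 0%N I.
  by have [_] := Dx n.+1 I; apply; exists n => /=.
have [N DN] := measure_bigcap_small e20 mD nD D0.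
exists (\bigcup_(n < N) C n), (\bigcup_n U n); split => //.
- by move=> x [n _ Cnx]; exists n => //; have [_ _ + _ _] := CUP n; apply.
- by move=> x [n _ Snx]; exists n => //; have [_ _ _ + _] := CUP n; apply.
have mgaps : measurable (\bigcup_n (v @^-1` (U n `\` C n))).
  exact: bigcupT_measurable.
apply: (@le_lt_trans _ _ (mu ((\bigcup_n (v @^-1` (U n `\` C n))) `|`
    v @^-1` (\bigcup_n C n `\` \bigcup_(n < N) C n)))).
  apply: le_measure; rewrite ?inE; [exact: measurable_gap|exact: measurableU|].
  move=> x [[n _ Unx] nCx]; have [Cnx|Cnx] := pselect (C n (v x)).
    by right; split => //; exists n.
  by left; exists n.
apply: (le_lt_trans (measureU2 _ _ _)) => //.
rewrite [e]splitr EFinD; apply: lee_ltD => //.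
  by rewrite ge0_fin_numE ?measure_ge0// ltey_eq fin_num_measure.
apply: measure_bigcup_le_geometric => //; first exact: ltW.
by move=> n; have [_ _ _ _ /ltW] := CUP n.
Qed.

Lemma sigma_closed_open_approx (S : set E) :
  <<s open >> S -> closed_open_approx S.
Proof.
move: S; apply: smallest_sub => [|U]; last exact: open_closed_open_approx.
split; first exact: open_closed_open_approx open0.
  by move=> S aS; rewrite setTD; exact: closed_open_approxC.
by move=> S; exact: closed_open_approx_bigcup.
Qed.

End inner_regularity.

Section compact_families.
Context d (T : measurableType d) (R : realType).
Variable mu : {finite_measure set T -> \bar R}.
Context (n : nat) (v : T -> 'rV[R]_n).
Hypothesis mv : forall U : set 'rV[R]_n, open U -> measurable (v @^-1` U).
Hypothesis range_borel : <<s open >> (range v).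
Hypothesis preimage_borel : forall B, measurable B ->
  exists2 S, <<s open >> S & B = v @^-1` S.

(** Since the range of [v] is Borel, a measurable set of [T] can be approximated by
sets that are closed in the whole Euclidean space; large balls make them compact. *)
Lemma compact_inner_regular (B : set T) (e : R) : measurable B -> (0 < e)%R ->
  exists C, [/\ compact C, closed C, C `<=` range v, v @^-1` C `<=` B &
    mu (B `\` v @^-1` C) < e%:E].
Proof.
move=> mB e0; have [S bS BS] := preimage_borel mB.
have e20 : (0 < e / 2)%R by rewrite divr_gt0.
have bSv : <<s open >> (S `&` range v).
  exact: (@measurableI _ (g_sigma_algebraType (@open 'rV[R]_n))).
have [C [U [cC oU CS SU CUe]]] := sigma_closed_open_approx mu mv bSv e20.
pose D (N : nat) := [set x : 'rV[R]_n | (`|x| <= N%:R)%R].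
have cD N : closed (D N).
  apply: (@closed_comp _ _ (fun x : 'rV[R]_n => `|x|%R) [set y : R | (y <= N%:R)%R]).
    by move=> x _; exact: norm_continuous.
  exact: closed_le.
have mD N : measurable (v @^-1` (~` D N)) by apply: (mv _); exact: closed_openC.
have nD : nonincreasing_seq (fun N => v @^-1` (~` D N)).
  move=> i j ij; apply/subsetPset => x /= xj xi; apply: xj.
  by apply: (le_trans xi); rewrite ler_nat.
have D0 : \bigcap_N (v @^-1` (~` D N)) = set0.
  apply/seteqP; split => // x /= xD.
  apply: (xD (Num.truncn `|v x|%R).+1 I); apply: ltW; exact: truncnS_gt.
have [N DN] := measure_bigcap_small mu e20 mD nD D0.
have mDC : measurable (v @^-1` (U `\` C)).
  apply: measurableD; first exact: (mv oU).
  rewrite -[X in measurable X]/(v @^-1` C) -(setCK C) preimage_setC.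
  by apply: measurableC; exact: (mv (closed_openC cC)).
have cCD : closed (C `&` D N) by exact: closedI.
exists (C `&` D N); split.
- apply: bounded_closed_compact; last exact: closedI.
  exists N%:R; split; first exact: num_real.
  by move=> M NM x [_ /= xN]; apply: (le_trans xN); exact: ltW.
- exact: closedI.
- by move=> x [/CS[]].
- by rewrite BS => x [/CS[]].
- apply: (@le_lt_trans _ _ (mu (v @^-1` (U `\` C) `|` v @^-1` (~` D N)))).
    apply: le_measure; rewrite ?inE; [|exact: measurableU|].
      apply: measurableD => //.
      rewrite -(setCK (C `&` D N)) preimage_setC; apply: measurableC.
      exact: (mv (closed_openC cCD)).
    rewrite BS => x [Sx nCx]; have [Dx|Dx] := pselect (D N (v x)); last by right.
    left; split; first by apply: SU; split => //; exists x.
    by move=> Cx; apply: nCx; split.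
  apply: (le_lt_trans (measureU2 _ _ _)) => //.
  by rewrite [e]splitr EFinD; apply: lteD.
Qed.

(** A form of Lusin's theorem for countably many sets at once. Up to a small error,
[S i] and its complement are replaced by compact sets [F i] and [G i]; on the
intersection [K] of the [F i `|` G i], each [S i] is clopen. The conclusion is
expressed with ultrafilters, for which compactness yields limits of arbitrary
sequences without extracting subsequences. *)
Lemma almost_continuous_family (S : (set T)^nat) (e : R) :
  (forall i, measurable (S i)) -> (0 < e)%R ->
  exists K, [/\ measurable K, mu (~` K) <= e%:E &
    forall (x : nat -> T) (U : set_system nat), UltraFilter U ->
    (forall j, K (x j)) ->
    exists2 z, K z & forall i, S i z -> U [set j | S i (x j)]].
Proof.
move=> mS e0.
have en0 i : (0 < e / (2 ^ i.+1)%:R / 2)%R.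
  by rewrite !divr_gt0// ltr0n expn_gt0.
have /choice[F FP] : forall i, exists C, [/\ compact C, closed C, C `<=` range v,
    v @^-1` C `<=` S i & mu (S i `\` v @^-1` C) < (e / (2 ^ i.+1)%:R / 2)%:E].
  by move=> i; exact: compact_inner_regular.
have /choice[G GP] : forall i, exists C, [/\ compact C, closed C, C `<=` range v,
    v @^-1` C `<=` ~` S i & mu (~` S i `\` v @^-1` C) < (e / (2 ^ i.+1)%:R / 2)%:E].
  by move=> i; apply: compact_inner_regular => //; exact: measurableC.
have mclosed (C : set 'rV[R]_n) : closed C -> measurable (v @^-1` C).
  move=> cC; rewrite -(setCK C) preimage_setC; apply: measurableC.
  exact: (mv (closed_openC cC)).
have mF i : measurable (v @^-1` F i) by apply: mclosed; have [] := FP i.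
have mG i : measurable (v @^-1` G i) by apply: mclosed; have [] := GP i.
have cFG i : closed (F i `|` G i).
  by apply: closedU; [have [] := FP i|have [] := GP i].
have mFG i : measurable (v @^-1` (F i `|` G i)) by exact: mclosed.
exists (\bigcap_i v @^-1` (F i `|` G i)); split.
- exact: bigcapT_measurable.
- rewrite setC_bigcap; apply: measure_bigcup_le_geometric; first exact: ltW.
    by move=> i; exact: measurableC.
  move=> i; apply: (@le_trans _ _ (mu ((S i `\` v @^-1` F i) `|` (~` S i `\` v @^-1` G i)))).
    apply: le_measure; rewrite ?inE.
    + exact: measurableC.
    + by apply: measurableU; apply: measurableD => //; exact: measurableC.
    + move=> x /= nFGx; have [Sx|Sx] := pselect (S i x); [left|right]; split => //.
        by move=> Fx; apply: nFGx; left.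
      by move=> Gx; apply: nFGx; right.
  apply: (le_trans (measureU2 _ _ _)).
  + by apply: measurableD.
  + by apply: measurableD => //; exact: measurableC.
  rewrite [(_ / _)%R]splitr EFinD; apply: leeD.
    by have [_ _ _ _ /ltW] := FP i.
  by have [_ _ _ _ /ltW] := GP i.
- move=> x U UU xK.
  have clU i : (v \o x @ U) (F i `|` G i).
    apply: (@filterS _ U _ setT) filterT => j _; exact: (xK j i I).
  have cFG0 : compact (F 0%N `|` G 0%N).
    by apply: compactU; [have [] := FP 0%N|have [] := GP 0%N].
  have [y [_]] := cFG0 (v \o x @ U) _ (clU 0%N).
  rewrite clusterE => ycl.
  have yFG i : (F i `|` G i) y by apply: (cFG i); exact: (ycl _ (clU i)).
  have [z _ zy] : range v y.
    by case: (yFG 0%N) => [Fy|Gy]; [have [_ _ + _ _] := FP 0%N|have [_ _ + _ _] := GP 0%N]; apply.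
  exists z; first by move=> i _; rewrite /preimage/= zy; exact: yFG.
  move=> i Sz; have [//|nU] := in_ultra_setVsetC [set j | S i (x j)] UU.
  suff : (~` S i) z by [].
  have [_ cG _ GS _] := GP i; apply: GS; rewrite /= zy.
  apply: cG; apply: ycl.
  rewrite /= /fmap /=; apply: (@filterS _ U _ _ _ _ nU) => j /= nSj.
  have [Fx|//] := xK j i I; exfalso; apply: nSj.
  by have [_ _ _ + _] := FP i; apply.
Qed.

End compact_families.

(** * Separability and gaps for a metric with measurable balls *)

Section metric_measure.
Context d (T : measurableType d) (R : realType) (omega : T -> T -> R).
Hypothesis omegaP : is_metric omega.
Hypothesis mball : forall a r, measurable [set y | (omega a y < r)%R].

Let omega_ge0 x y : (0 <= omega x y)%R. Proof. by case: omegaP. Qed.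
Let omega_eq0 x y : omega x y = 0%R -> x = y. Proof. by case: omegaP => _ /(_ x y)[]. Qed.
Let omegaC x y : omega x y = omega y x. Proof. by case: omegaP. Qed.
Let omega_triangle x y z : (omega x z <= omega x y + omega y z)%R.
Proof. by case: omegaP. Qed.

(** Otherwise one could keep adding points at distance at least [r] from the previous
ones; the balls of radius [r / 2] around them are disjoint and each has mass at
least [c], which exceeds the total mass of [nu] eventually. *)
Lemma finite_net (nu : {finite_measure set T -> \bar R}) (r c : R) : (0 < c)%R ->
  (forall x, c%:E <= nu [set y | (omega x y < r / 2)%R]) ->
  exists s : seq T, forall x, exists2 a, a \in s & (omega a x < r)%R.
Proof.
move=> c0 cB; apply: contrapT => /forallNP nonet.
have packing n : exists (s : seq T) (U : set T), [/\ measurable U,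
    forall y, U y -> exists2 a, a \in s & (omega a y < r / 2)%R &
    (n%:R * c)%:E <= nu U].
  elim: n => [|n [s [U [mU Us nU]]]].
    by exists [::], set0; split => //; rewrite mul0r measure0.
  have /existsNP[x xs] := nonet s.
  pose B := [set y | (omega x y < r / 2)%R].
  have mB : measurable B by exact: mball.
  exists (x :: s), (U `|` B); split; first exact: measurableU.
    move=> y [/Us[a sa ay]|xy]; first by exists a; rewrite // inE sa orbT.
    by exists x; rewrite // mem_head.
  rewrite measureU//; last first.
    apply/seteqP; split => // y [/Us[a sa ay] xy]; apply: xs; exists a => //.
    rewrite [r]splitr; apply: le_lt_trans (omega_triangle _ y _) _.
    by rewrite ltrD// (omegaC y).
  by rewrite -natr1 mulrDl mul1r EFinD leeD//; exact: cB.
have [s [U [mU _ nU]]] := packing (Num.truncn (fine (nu setT) / c)).+1.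
have : nu U <= nu setT by apply: le_measure; rewrite ?inE.
move/(le_trans nU); rewrite -[nu setT]fineK ?fin_num_measure// lee_fin.
by rewrite -ler_pdivlMr// leNgt truncnS_gt.
Qed.

Lemma dense_sequence (nu : {finite_measure set T -> \bar R}) :
  (forall r, (0 < r)%R -> exists2 c, (0 < c)%R &
    forall x, c%:E <= nu [set y | (omega x y < r)%R]) ->
  exists D : nat -> T, forall x r, (0 < r)%R -> exists i, (omega (D i) x < r)%R.
Proof.
move=> nuB.
have /choice[s sP] : forall n : nat, exists s : seq T,
    forall x, exists2 a, a \in s & (omega a x < n.+1%:R^-1)%R.
  move=> n; have n0 : (0 < n.+1%:R^-1 / 2 :> R)%R by rewrite divr_gt0// invr_gt0.
  by have [c c0 cB] := nuB _ n0; exact: finite_net c0 cB.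
exists (fun i => if unpickle i is Some (n, l) then nth point (s n) l else point).
move=> x r r0; have [n _ /(_ n (leqnn n)) nr] := near_infty_natSinv_lt (PosNum r0).
have [a asn ax] := sP n x.
exists (pickle (n, index a (s n))); rewrite pickleK nth_index//.
exact: lt_trans nr.
Qed.

(** The hypothesis on [S] is the conclusion of [almost_continuous_family]. If there
were no gap, there would be pairs of points of [K] at vanishing distance and on
different levels. Limits [x] and [y] of the two components along an ultrafilter lie in
the same small balls as the components themselves, so [omega x y = 0]; but being in
a level set also passes from the limit to the sequence. *)
Lemma level_gap (mu : {finite_measure set T -> \bar R}) (lev : T -> nat)
  (D : nat -> T) (e : R) :
  (forall x r, (0 < r)%R -> exists i, (omega (D i) x < r)%R) ->
  (forall p, measurable [set x | lev x = p]) ->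
  (forall S : (set T)^nat, (forall i, measurable (S i)) ->
    exists K, [/\ measurable K, mu (~` K) <= e%:E &
    forall (x : nat -> T) (U : set_system nat), UltraFilter U ->
    (forall j, K (x j)) ->
    exists2 z, K z & forall i, S i z -> U [set j | S i (x j)]]) ->
  exists K, [/\ measurable K, mu (~` K) <= e%:E &
    exists2 t, (0 < t)%R &
      forall x y, K x -> K y -> (omega x y < t)%R -> lev x = lev y].
Proof.
move=> Ddense mlev compactK.
pose S (i : nat) := match unpickle i : option (nat * nat + nat)%type with
  | Some (inl (i, j)) => [set y | (omega (D i) y < j.+1%:R^-1)%R]
  | Some (inr p) => [set x | lev x = p]
  | None => set0 end.
have SE (s : (nat * nat + nat)%type) : S (pickle s) =
    match s with inl (i, j) => [set y | (omega (D i) y < j.+1%:R^-1)%R]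
    | inr p => [set x | lev x = p] end by rewrite /S pickleK.
have mS i : measurable (S i) by rewrite /S; case: unpickle => [[[]|]|].
have [K [mK Ke KU]] := compactK S mS; exists K; split => //.
apply: contrapT => /forall2NP nogap.
have /choice[xy xyP] : forall n : nat, exists xy : T * T,
    [/\ K xy.1, K xy.2, (omega xy.1 xy.2 < n.+1%:R^-1)%R & lev xy.1 <> lev xy.2].
  move=> n; apply: contrapT => nxy; have [|] := nogap n.+1%:R^-1%R; first by rewrite invr_gt0.
  apply => x y Kx Ky xy; apply: contrapT => levxy; apply: nxy.
  by exists (x, y); split.
have [U [UU ooU]] := ultraFilterLemma eventually_filter.
have [x Kx xU] := KU (fun j => (xy j).1) U UU (fun j => let: And4 k _ _ _ := xyP j in k).
have [y Ky yU] := KU (fun j => (xy j).2) U UU (fun j => let: And4 _ k _ _ := xyP j in k).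
(* [x] and [y] are compared through five distances, two of them to dense centres
   [D a] and [D b]. *)
have xy0 : x = y.
  apply: omega_eq0; apply/eqP; rewrite eq_le omega_ge0 andbT.
  rewrite leNgt; apply/negP => r0.
  have r50 : (0 < omega x y / 5)%R by rewrite divr_gt0.
  have [n _ nr] := near_infty_natSinv_lt (PosNum r50).
  have n0 : (0 < n.+1%:R^-1 :> R)%R by rewrite invr_gt0.
  have [a xa] := Ddense x _ n0; have [b yb] := Ddense y _ n0.
  have := xU (pickle (inl (a, n) : (nat * nat + nat)%type)).
  rewrite SE => /(_ xa) Ux.
  have := yU (pickle (inl (b, n) : (nat * nat + nat)%type)).
  rewrite SE => /(_ yb) Uy.
  have UN : U [set j | (n <= j)%N] by apply: ooU; exact: nbhs_infty_ge.
  have [j [[/= xja yjb] nj]] := filter_ex (filterI (filterI Ux Uy) UN).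
  have [_ _ xyj _] := xyP j; move: xa yb => /= xa yb.
  have nr5 : (n.+1%:R^-1 < omega x y / 5)%R by exact: nr n (leqnn n).
  have jr5 : (j.+1%:R^-1 < omega x y / 5)%R by exact: nr j nj.
  have := lt_trans xa nr5; have := lt_trans yb nr5; have := lt_trans xja nr5.
  have := lt_trans yjb nr5; have := lt_trans xyj jr5.
  have := omega_triangle x (D a) y; have := omega_triangle (D a) (xy j).1 y.
  have := omega_triangle (xy j).1 (xy j).2 y.
  have := omega_triangle (xy j).2 (D b) y.
  rewrite (omegaC x (D a)) (omegaC (xy j).2 (D b)); lra.
have := xU (pickle (inr (lev x) : (nat * nat + nat)%type)).
have := yU (pickle (inr (lev x) : (nat * nat + nat)%type)).
rewrite SE xy0 => /(_ erefl) Uy /(_ erefl) Ux.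
have [j [/= xj yj]] := filter_ex (filterI Ux Uy).
by have [_ _ _] := xyP j; rewrite xj yj.
Qed.

End metric_measure.

(** * Derandomized random coding *)

Section random_coding.
Context dZ dY (Z : measurableType dZ) (Y : measurableType dY) (R : realType).
Variable kappa : {sigma_finite_measure set Z -> \bar R}.
Variable mu : {sigma_finite_measure set Y -> \bar R}.
Variable w : Y -> R.
Hypothesis mw : measurable_fun setT w.
Hypothesis w0 : forall y, (0 <= w y)%R.
Hypothesis intw : \int[mu]_y (w y)%:E = 1.

Lemma le_weighted_mean (F : Y -> \bar R) : measurable_fun setT F ->
  (forall y, 0 <= F y) -> exists y, F y <= \int[mu]_y ((w y)%:E * F y).
Proof.
move=> mF F0; set c := \int[mu]_y _; apply: contrapT => /forallNP cF.
have {}cF y : c < F y by rewrite ltNge; apply/negP; exact: cF.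
have c0 : 0 <= c by apply: integral_ge0 => y _; rewrite mule_ge0 ?lee_fin.
have cfin : c \is a fin_num by rewrite ge0_fin_numE// (lt_le_trans (cF point)) ?leey.
have mwE : measurable_fun setT (EFin \o w) by exact/measurable_EFinP.
have mFc : measurable_fun setT (fun y => F y - c) by exact: emeasurable_funB.
have FcE y : (w y)%:E * F y = (w y)%:E * c + (w y)%:E * (F y - c).
  rewrite -ge0_muleDr//; first by rewrite addeC subeK.
  by rewrite sube_ge0 ?cfin// ltW.
have G0 y : 0 <= (w y)%:E * (F y - c).
  by rewrite mule_ge0 ?lee_fin// sube_ge0 ?cfin// ltW.
have : c = c + \int[mu]_y ((w y)%:E * (F y - c)).
  rewrite {1}/c; under eq_integral do rewrite FcE.
  rewrite ge0_integralD//.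
  - by rewrite ge0_integralZr//= ?intw ?mul1e// => y _; rewrite lee_fin.
  - by move=> y _; rewrite mule_ge0 ?lee_fin.
  - exact: emeasurable_funM.
  - exact: emeasurable_funM.
have mG : measurable_fun setT (fun y => (w y)%:E * (F y - c)).
  exact: emeasurable_funM.
move=> cG.
have intG0 : \int[mu]_y ((w y)%:E * (F y - c)) = 0.
  apply/eqP; rewrite eq_le integral_ge0// andbT leNgt; apply/negP => G_gt0.
  by have := ltxx c; rewrite {2}cG lteDl// G_gt0.
have /ae_eq_integral_abs : \int[mu]_y `|(w y)%:E * (F y - c)| = 0.
  by under eq_integral do rewrite gee0_abs//.
move=> /(_ measurableT mG) G_ae0.
suff : \int[mu]_y (w y)%:E = 0 by rewrite intw => /eqP; rewrite onee_eq0.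
rewrite (@ge0_ae_eq_integral _ _ _ mu setT _ (cst 0) measurableT) ?integral0//.
  by move=> y _; rewrite lee_fin.
apply: filterS G_ae0 => y /(_ I)/= /eqP; rewrite mule_eq0 => /orP[/eqP//|].
  by rewrite gt_eqF// sube_gt0.
Qed.

(** Method of conditional expectations: once [y1, ..., yj] are chosen, the integral of
[u * \prod_(i <= j) \1_S (z, yi) * q ^ (n - j)] is the expected loss when the
remaining points are drawn at random, and by [le_weighted_mean] the next point can
be chosen without increasing it. *)
Lemma derandomized_coding (S : set (Z * Y)) (q : Z -> R) (u : Z -> \bar R) n :
  measurable S -> measurable_fun setT q -> (forall z, 0 <= q z)%R ->
  (forall z, \int[mu]_y (w y * \1_S (z, y))%:E = (q z)%:E) ->
  measurable_fun setT u -> (forall z, 0 <= u z) ->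
  exists2 ys : seq Y, size ys = n &
    \int[kappa]_z (u z * (\prod_(y <- ys) \1_S (z, y))%:E) <=
    \int[kappa]_z (u z * (q z ^+ n)%:E).
Proof.
move=> mS mq q0 qE; elim: n u => [|n IHn] u meas_u u0.
  by exists [::] => //; under eq_integral do rewrite big_nil.
have mqn : measurable_fun setT (fun z => (q z ^+ n)%:E).
  by apply/measurable_EFinP; exact: measurable_funX.
have mS1 : measurable_fun setT (fun zy : Z * Y => (\1_S zy : R)%:E).
  by apply/measurable_EFinP; exact: measurable_indic.
pose h (yz : Y * Z) := u yz.2 * ((\1_S (yz.2, yz.1))%:E * (q yz.2 ^+ n)%:E).
have h0 yz : 0 <= h yz.
  by rewrite /h mule_ge0// mule_ge0 ?lee_fin ?exprn_ge0.
have mh : measurable_fun setT h.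
  apply: emeasurable_funM; first exact: measurableT_comp.
  apply: emeasurable_funM; last exact: (measurableT_comp mqn).
  apply: (measurableT_comp mS1); exact: measurable_fun_pair.
pose F y := \int[kappa]_z h (y, z).
have mF : measurable_fun setT F.
  exact: (measurable_fun_fubini_tonelli_F _ mh).
have F0 y : 0 <= F y by exact: integral_ge0.
have [y Fy] := le_weighted_mean mF F0.
have mS1y : measurable_fun setT (fun z => (\1_S (z, y) : R)%:E).
  by apply: (measurableT_comp mS1); exact: measurable_fun_pair.
have mu1 : measurable_fun setT (fun z => u z * (\1_S (z, y))%:E).
  exact: emeasurable_funM.
have u10 z : 0 <= u z * (\1_S (z, y))%:E by rewrite mule_ge0 ?lee_fin.
have mwS z : measurable_fun setT (fun x => (w x * \1_S (z, x))%:E).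
  apply/measurable_EFinP; apply: measurable_funM => //.
  by apply/measurable_EFinP; apply: (measurableT_comp mS1); exact: measurable_fun_pair.
have [ys ysn ysq] := IHn _ mu1 u10.
exists (y :: ys) => /=; first by rewrite ysn.
under eq_integral do rewrite big_cons EFinM muleA.
apply: (le_trans ysq); under eq_integral do rewrite -muleA.
apply: (le_trans Fy).
have -> : \int[mu]_y0 ((w y0)%:E * F y0) =
    \int[mu]_y0 \int[kappa]_z ((w y0)%:E * h (y0, z)).
  apply: eq_integral => y0 _; rewrite ge0_integralZl//= ?lee_fin//.
  by apply: (measurableT_comp mh); exact: measurable_fun_pair.
rewrite (@fubini_tonelli _ _ _ _ _ mu kappa (fun yz => (w yz.1)%:E * h yz))//.
- rewrite le_eqVlt; apply/orP; left; apply/eqP; apply: eq_integral => z _ /=.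
  rewrite exprS EFinM -qE [X in u z * X]muleC.
  rewrite -ge0_integralZl//=.
  + rewrite -ge0_integralZl//=.
    * by apply: eq_integral => y0 _; rewrite /h/= EFinM muleCA; congr *%E; rewrite muleA muleC.
    * by apply: emeasurable_funM => //; exact: mwS.
    * by move=> y0 _; rewrite -EFinM lee_fin !mulr_ge0// exprn_ge0.
  + by move=> y0 _; rewrite lee_fin mulr_ge0.
  + by rewrite lee_fin exprn_ge0.
- apply: emeasurable_funM => //; apply/measurable_EFinP.
  exact: measurableT_comp.
- by move=> yz; rewrite mule_ge0 ?lee_fin.
Qed.

End random_coding.

Section nearest.
Context (R : realType) dX dY (TX : measurableType dX) (TY : measurableType dY).
Variable rho : TX -> TY -> \bar R.
Hypothesis rhoP : distortion_function rho.

(** Ties are resolved by order in the list, so that the choice is measurable. *)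
Fixpoint nearest (y0 : TY) (ys : seq TY) (x : TX) : TY :=
  if ys is y :: ys' then
    if rho x y0 <= rho x (nearest y ys' x) then y0 else nearest y ys' x
  else y0.

Lemma nearest_in y0 ys x : nearest y0 ys x \in y0 :: ys.
Proof.
elim: ys y0 => [|y ys IH] y0 /=; first exact: mem_head.
by case: ifP => _; rewrite in_cons ?eqxx// IH orbT.
Qed.

Lemma nearest_le y0 ys x y : y \in y0 :: ys -> rho x (nearest y0 ys x) <= rho x y.
Proof.
elim: ys y0 => [|y1 ys IH] y0 /=; first by rewrite inE => /eqP ->.
rewrite inE => /predU1P[->|/IH yys]; first by case: ifPn => //; rewrite -ltNge => /ltW.
by case: ifPn => // /le_trans; apply.
Qed.

Lemma measurable_distortion (f : TX -> TY) : measurable_fun setT f ->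
  measurable_fun setT (fun x => rho x (f x)).
Proof.
move=> mf; have [_ mrho] := rhoP.
have mxf : measurable_fun setT (fun x => (x, f x)) by exact: measurable_fun_pair.
exact: (measurableT_comp mrho mxf).
Qed.

Lemma measurable_nearest y0 ys : measurable_fun setT (nearest y0 ys).
Proof.
elim: ys y0 => [|y ys IH] y0 /=; first exact: measurable_cst.
apply: measurable_fun_ifT => //; apply: measurable_fun_lee.
  exact: (measurable_distortion (measurable_cst y0)).
exact: measurable_distortion.
Qed.

Lemma range_nearest y0 ys : (range (nearest y0 ys) #<= `I_(size ys).+1)%card.
Proof.
apply: card_le_trans (card_image_le (nth y0 (y0 :: ys)) _).
apply: subset_card_le => _ [x _ <-].
exists (index (nearest y0 ys x) (y0 :: ys)); last by rewrite nth_index ?nearest_in.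
by have := nearest_in y0 ys x; rewrite -index_mem.
Qed.

End nearest.

Lemma layer_cake (R : realType) (r : \bar R) : 0 <= r ->
  \int[lebesgue_measure]_(t in `]0%R, +oo[) (\1_[set s : R | (s%:E < r)%E] t)%:E = r.
Proof.
move=> r0.
have -> : [set s : R | s%:E < r] = [set` Interval -oo%O (if r is s%:E then BLeft s else +oo%O)].
  by case: r r0 => [r| |] // _; apply/seteqP; split => s /=; rewrite in_itv/= ?lte_fin ?ltry.
rewrite integral_indic//= -set_itvI/= lebesgue_measure_itv/=.
case: r r0 => [r| |]//=; rewrite ?lee_fin => r0.
  rewrite lte_fin oppr0 addr0; case: ltP => // r0'.
  by congr EFin; apply/eqP; rewrite eq_le r0 r0'.
by rewrite ltry oppr0 adde0.
Qed.

(** The product of two sigma-finite measures packed as a sigma-finite measure, so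
that Tonelli's theorem can be applied to a product with a third space. *)
Lemma sigma_finite_product (R : realType) d1 d2 (T1 : measurableType d1)
    (T2 : measurableType d2) (m1 : {sigma_finite_measure set T1 -> \bar R})
    (m2 : {sigma_finite_measure set T2 -> \bar R}) :
  exists k : {sigma_finite_measure set (T1 * T2)%type -> \bar R},
    (k : set (T1 * T2)%type -> \bar R) = m1 \x m2.
Proof.
have sf : sigma_finite setT (m1 \x m2).
  have /sigma_finiteP[F [TF ndF Foo]] := sigma_finiteT m1.
  have /sigma_finiteP[G [TG ndG Goo]] := sigma_finiteT m2.
  exists (fun n => F n `*` G n).
    apply/seteqP; split => // -[x y] _.
    have [n _ Fx] : (\bigcup_n F n) x by rewrite -TF.
    have [k _ Gy] : (\bigcup_n G n) y by rewrite -TG.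
    exists (maxn n k) => //; split => /=.
      by move: x Fx; exact/subsetPset/ndF/leq_maxl.
    by move: y Gy; exact/subsetPset/ndG/leq_maxr.
  move=> k; have [mF Fk] := Foo k; have [mG Gk] := Goo k.
  split; first exact: measurableX.
  by rewrite product_measure1E// lte_mul_pinfty// ge0_fin_numE.
pose mk := Measure_isSigmaFinite.Build _ _ _ _ sf.
exists (HB.pack_for {sigma_finite_measure set (T1 * T2)%type -> \bar R} (m1 \x m2) mk).
by [].
Qed.

Section quantization_bound.
Context (R : realType) dX dY (TX : measurableType dX) (TY : measurableType dY).
Context dO (O : measurableType dO) (P : probability O R) (X : {RV P >-> TX}).
Variable rho : TX -> TY -> \bar R.
Hypothesis rhoP : distortion_function rho.
Variables (la : {sigma_finite_measure set TY -> \bar R}) (w : TY -> R).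
Hypothesis mw : measurable_fun setT w.
Hypothesis w0 : forall y, (0 <= w y)%R.
Hypothesis intw : \int[la]_y (w y)%:E = 1.

(** The probability, for one draw from the density [w], of missing [x] by more than
[t]. *)
Definition miss (x : TX) (t : R) : R :=
  fine (\int[la]_(y in [set y | t%:E < rho x y]) (w y)%:E).

Local Notation Z := (TX * measurableTypeR R)%type.

Let S : set (Z * TY) := [set zy | zy.1.2%:E < rho zy.1.1 zy.2].

Let mS : measurable S.
Proof.
have [_ mrho] := rhoP.
have m2 : measurable_fun setT (fun zy : Z * TY => (zy.1.2 : R)%:E).
  apply: (measurableT_comp (@EFin_measurable R setT)).
  exact: (measurableT_comp measurable_snd measurable_fst).
have mxy : measurable_fun setT (fun zy : Z * TY => (zy.1.1, zy.2)).
  apply: measurable_fun_pair => //.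
  exact: (measurableT_comp measurable_fst).
have mr : measurable_fun setT (fun zy : Z * TY => rho zy.1.1 zy.2).
  exact: (measurableT_comp mrho mxy).
by have := measurable_lte measurableT m2 mr; rewrite setTI.
Qed.

Let missE (z : Z) : miss z.1 z.2 = fine (\int[la]_y (w y * \1_S (z, y))%:E).
Proof.
rewrite /miss integral_mkcond; congr fine; apply: eq_integral => y _.
rewrite patchE indicE.
have -> : (y \in [set y | z.2%:E < rho z.1 y]) = ((z, y) \in S).
  by apply/idP/idP; rewrite !inE.
by case: (_ \in S); rewrite ?mulr1 ?mulr0.
Qed.

Let mwS : measurable_fun setT (fun zy : Z * TY => (w zy.2 * \1_S zy)%:E).
Proof.
apply/measurable_EFinP; apply: measurable_funM; last exact: measurable_indic.
exact: measurableT_comp.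
Qed.

Let wS0 (zy : Z * TY) : 0 <= (w zy.2 * \1_S zy)%:E.
Proof. by rewrite lee_fin mulr_ge0. Qed.

Let hit_fin (z : Z) : \int[la]_y (w y * \1_S (z, y))%:E \is a fin_num.
Proof.
rewrite ge0_fin_numE; last by apply: integral_ge0 => y _; exact: (wS0 (z, y)).
apply: (@le_lt_trans _ _ 1); last exact: ltry.
rewrite -intw; apply: ge0_le_integral => //.
- by move=> y _; exact: (wS0 (z, y)).
- have mpz : measurable_fun setT (fun y : TY => (z, y)) by exact: measurable_fun_pair.
  exact: (measurableT_comp mwS mpz).
- by apply/measurable_EFinP.
- by move=> y _; rewrite lee_fin ler_piMr// indicE; case: (_ \in _).
Qed.

Lemma measurable_miss : measurable_fun setT (fun z : Z => miss z.1 z.2).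
Proof.
have mint : measurable_fun setT (fun z => \int[la]_y (w y * \1_S (z, y))%:E).
  exact: (measurable_fun_fubini_tonelli_F _ mwS wS0).
rewrite (_ : (fun _ => _) = fun z => fine (\int[la]_y (w y * \1_S (z, y))%:E)).
  exact: (measurableT_comp (fine_measurable measurableT)).
by apply/funext => z; exact: missE.
Qed.

Lemma miss_ge0 x t : (0 <= miss x t)%R.
Proof.
by rewrite (missE (x, t)) fine_ge0// integral_ge0// => y _; exact: (wS0 ((x, t), y)).
Qed.

Lemma miss_le_expR (x : TX) (t p : R) (B : set TY) : measurable B ->
  (forall y, B y -> rho x y <= t%:E) -> p%:E <= \int[la]_(y in B) (w y)%:E ->
  (miss x t <= expR (- p))%R.
Proof.
move=> mB Bt pB; apply: (@le_trans _ _ (1 - p)%R); last exact: expR_ge1Dx.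
have mwE : measurable_fun setT (EFin \o w) by apply/measurable_EFinP.
have mA : measurable [set y | t%:E < rho x y].
  have := measurable_xsection (x, t) mS; rewrite (_ : xsection _ _ = [set y | t%:E < rho x y])//.
  by apply/seteqP; split => [y /xsectionP//|y Sy]; exact/xsectionP.
have w0E (A : set TY) : 0 <= \int[la]_(y in A) (w y)%:E.
  by apply: integral_ge0 => y _; rewrite lee_fin.
have disj : [disjoint [set y | t%:E < rho x y] & B]%classic.
  by apply/disj_setPS => y [ty /Bt]; rewrite leNgt => /negP; apply.
have sum_le1 : \int[la]_(y in [set y | t%:E < rho x y]) (w y)%:E +
    \int[la]_(y in B) (w y)%:E <= 1.
  rewrite -intw -ge0_integral_setU//.
  - by apply: ge0_subset_integral => //; [exact: measurableU|move=> y _; rewrite lee_fin].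
  - exact: measurable_funTS.
  - by move=> y _; rewrite lee_fin.
have finA : \int[la]_(y in [set y | t%:E < rho x y]) (w y)%:E \is a fin_num.
  rewrite ge0_fin_numE// (@le_lt_trans _ _ 1) ?ltry//.
  by apply: le_trans sum_le1; rewrite leeDl.
rewrite lerBrDr -lee_fin EFinD /miss fineK//.
by apply: le_trans sum_le1; rewrite leeD2l.
Qed.

Lemma miss_eq0 x t : (forall y, rho x y <= t%:E) -> miss x t = 0%R.
Proof.
move=> rhot; rewrite /miss (_ : [set y | _] = set0) ?integral_set0//.
by apply/seteqP; split => // y /=; rewrite ltNge rhot.
Qed.

(** By [layer_cake], the distortion of the nearest code point is the integral over
[t > 0] of the indicator that all code points are farther than [t], which is a
product of indicators as in [derandomized_coding], over the space of pairs [(x, t)]. *)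
Lemma quantization_error_le_miss n (G : TX -> \bar R) :
  measurable_fun setT G ->
  (forall x, \int[lebesgue_measure]_(t in `]0%R, +oo[) (miss x t ^+ n.+1)%:E <= G x) ->
  quantization_error X rho n.+1 <= \int[distribution P X]_x G x.
Proof.
move=> mG missG; have [rho0 _] := rhoP.
have miss0 (z : Z) : (0 <= miss z.1 z.2)%R by exact: miss_ge0.
pose u (z : Z) : \bar R := (\1_(`]0%R, +oo[%classic : set R) z.2)%:E.
have meas_u : measurable_fun setT u.
  apply/measurable_EFinP.
  exact: (measurableT_comp (measurable_indic (measurable_itv _)) measurable_snd).
have u0 z : 0 <= u z by rewrite lee_fin.
have [kappa kappaE] := sigma_finite_product (distribution P X) (@lebesgue_measure R).
have [[//|y0 ys] /eqP] := derandomized_coding kappa mw w0 intw n.+1 mS measurable_miss miss0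
  (fun z => esym (etrans (congr1 EFin (missE z)) (fineK (hit_fin z)))) meas_u u0.
rewrite /= eqSS kappaE => /eqP ysn codele.
have mn := measurable_nearest rhoP y0 ys.
apply: (@le_trans _ _ (\int[distribution P X]_x rho x (nearest rho y0 ys x))).
  rewrite ge0_integral_distribution//; last exact: measurable_distortion.
  apply: ereal_inf_lbound => /=; exists (nearest rho y0 ys) => //; split => //.
  by rewrite -ysn; exact: range_nearest.
have mcode : measurable_fun setT
    (fun z : Z => u z * (\prod_(y <- y0 :: ys) \1_S (z, y))%:E).
  apply: emeasurable_funM => //; apply/measurable_EFinP.
  apply: measurable_prod => y _.
  apply: (measurableT_comp (measurable_indic mS)); exact: measurable_fun_pair.
have code0 (z : Z) : 0 <= u z * (\prod_(y <- y0 :: ys) \1_S (z, y))%:E.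
  by rewrite mule_ge0// lee_fin prodr_ge0.
have mmissn : measurable_fun setT (fun z : Z => u z * (miss z.1 z.2 ^+ n.+1)%:E).
  apply: emeasurable_funM => //; apply/measurable_EFinP.
  by apply: measurable_funX; exact: measurable_miss.
have missn0 (z : Z) : 0 <= u z * (miss z.1 z.2 ^+ n.+1)%:E.
  by rewrite mule_ge0// lee_fin exprn_ge0.
have patchu (g : R -> \bar R) (x : TX) : \int[lebesgue_measure]_(t in `]0%R, +oo[) g t =
    \int[lebesgue_measure]_t (u (x, t) * g t).
  rewrite integral_mkcond; apply: eq_integral => t _.
  by rewrite patchE /u/= indicE; case: (_ \in _); rewrite ?mul1e ?mul0e.
have le_G : \int[distribution P X \x lebesgue_measure]_z (u z * (miss z.1 z.2 ^+ n.+1)%:E) <=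
    \int[distribution P X]_x G x.
  rewrite fubini_tonelli1//; apply: ge0_le_integral => //.
  - by move=> x _; exact: integral_ge0.
  - exact: (measurable_fun_fubini_tonelli_F _ mmissn missn0).
  - by move=> x _; apply: le_trans (missG x); rewrite (patchu _ x).
apply: le_trans (le_trans codele le_G); rewrite fubini_tonelli1//.
apply: ge0_le_integral => //.
- exact: measurable_distortion.
- exact: (measurable_fun_fubini_tonelli_F _ mcode code0).
move=> x _; rewrite -[leLHS]layer_cake// (patchu _ x).
have mpx : measurable_fun setT (fun t : measurableTypeR R => (x, t)).
  exact: measurable_fun_pair.
apply: ge0_le_integral => //.
- by move=> t _; rewrite mule_ge0// lee_fin.
- apply: emeasurable_funM; first exact: (measurableT_comp meas_u mpx).
  apply/measurable_EFinP; apply: measurable_indic.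
  have := measurable_lte measurableT (@EFin_measurable R setT)
    (measurable_cst (rho x (nearest rho y0 ys x))).
  by rewrite setTI.
- exact: (measurableT_comp mcode mpx).
move=> t _; apply: lee_wpmul2l => //; rewrite lee_fin.
rewrite indicE; have [|_] := boolP (t \in _); last exact: prodr_ge0.
rewrite inE/= => tf; rewrite big1_seq// => y /andP[_ yys].
by rewrite indicE mem_set// /S/=; apply: (lt_le_trans tf); exact: nearest_le.
Qed.
End quantization_bound.

(** * Gamma integrals and exponential decay *)

Section gamma_integral.
Context (R : realType).
Local Notation leb := (@lebesgue_measure R).

Lemma integral_expR_tail (a : R) :
  \int[leb]_(s in `]a, +oo[) (expR (- s))%:E = (expR (- a))%:E.
Proof.
have cN : continuous (fun s : R => - s)%R by exact: opp_continuous.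
have ce : continuous (fun s : R => expR (- s)).
  by move=> s; apply: continuous_comp; [exact: cN|exact: continuous_expR].
rewrite integral_itv_obnd_cbnd; last first.
  apply/measurable_funTS/measurable_EFinP.
  exact: continuous_measurable_fun.
rewrite (@ge0_continuous_FTC2y R _ (fun s => - expR (- s))%R a 0%R).
- by rewrite add0e -EFinN opprK.
- by move=> x _; exact: expR_ge0.
- by apply: continuous_subspaceT => x; exact: ce.
- by rewrite -oppr0; apply: cvgN; exact: cvgr_expR.
- by move=> x _.
- by apply: cvg_at_right_filter; apply: cvgN; exact: ce.
- move=> x _; rewrite derive1E; apply/derive_val.
  by apply: is_derive_eq; rewrite mulrN1 opprK.
Qed.

Lemma ltr_powR_inv (alpha x y : R) : (0 < alpha)%R -> (0 <= x)%R -> (0 <= y)%R ->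
  (x < y `^ alpha)%R = (x `^ alpha^-1 < y)%R.
Proof.
move=> a0 x0 y0; have an0 := lt0r_neq0 a0; have ai0 : (0 < alpha^-1)%R by rewrite invr_gt0.
apply/idP/idP => xy.
  have := gt0_ltr_powR ai0 _ _ xy; rewrite !nnegrE powR_ge0 => /(_ x0 isT).
  by rewrite -powRrM mulfV// powRr1.
have := gt0_ltr_powR a0 _ _ xy; rewrite !nnegrE powR_ge0 => /(_ isT y0).
by rewrite -powRrM mulVf// powRr1.
Qed.

(** Tonelli's theorem replaces a change of variables: [expR (- a)] is the integral of
[expR (- s)] over [s > a], and [c * t ^ (1 / alpha) < s] means
[t < (s / c) ^ alpha]. *)
Lemma integral_expR_powR (alpha c : R) : (0 < alpha)%R -> (0 < c)%R ->
  \int[leb]_(t in `]0%R, +oo[) (expR (- (c * t `^ alpha^-1)))%:E =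
  (c `^ (- alpha))%:E * Gamma (1 + alpha).
Proof.
move=> alpha0 c0.
pose RR := measurableTypeR R.
pose above : set (RR * RR) := [set ts | (c * ts.1 `^ alpha^-1 < ts.2)%R].
pose f (ts : RR * RR) : \bar R :=
  (\1_(`]0%R, +oo[%classic : set R) ts.1 * (\1_above ts * expR (- ts.2)))%:E.
have f0 ts : 0 <= f ts by rewrite lee_fin !mulr_ge0// expR_ge0.
have mabove : measurable above.
  have m1 : measurable_fun setT (fun ts : RR * RR => (c * ts.1 `^ alpha^-1)%R).
    apply: measurable_funM => //.
    exact: (measurableT_comp (@measurable_powR R alpha^-1) (@measurable_fst _ _ RR RR)).
  have := measurable_fun_ltr m1 measurable_snd measurableT.
  by move=> /(_ [set true] Logic.I); rewrite setTI.
have mf : measurable_fun setT f.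
  apply/measurable_EFinP; apply: measurable_funM.
    exact: (measurableT_comp (measurable_indic (measurable_itv _)) measurable_fst).
  apply: measurable_funM; first exact: measurable_indic.
  have mN : measurable_fun setT (fun ts : RR * RR => - ts.2)%R.
    exact: (measurableT_comp (@oppr_measurable R setT) (@measurable_snd _ _ RR RR)).
  exact: (measurableT_comp (@measurable_expR R) mN).
have aboveE t s : (\1_above (t, s) : R) = ((c * t `^ alpha^-1 < s)%R)%:R.
  rewrite indicE; suff -> : ((t, s) \in above) = (c * t `^ alpha^-1 < s)%R by [].
  by apply/idP/idP; rewrite inE.
have inner t : (0 < t)%R -> \int[leb]_s f (t, s) = (expR (- (c * t `^ alpha^-1)))%:E.
  move=> t0; rewrite -integral_expR_tail [RHS]integral_mkcond.
  apply: eq_integral => s _; rewrite patchE /f/= aboveE indicE.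
  rewrite !mem_setE !in_itv/= !andbT t0 mul1r.
  by case: ifP; rewrite ?mul1r ?mul0r.
rewrite integral_mkcond.
transitivity (\int[leb]_t \int[leb]_s f (t, s)).
  apply: eq_integral => t _; rewrite patchE.
  rewrite mem_setE in_itv/= andbT; case: ifPn => t0; first by rewrite inner.
  by rewrite integral0_eq// => s _; rewrite /f/= indicE mem_setE in_itv/= andbT (negbTE t0) mul0r.
rewrite (@fubini_tonelli _ _ _ _ _ leb leb f mf f0).
rewrite /Gamma -ge0_integralZl//; first last.
- by rewrite lee_fin powR_ge0.
- by move=> s _; rewrite lee_fin mulr_ge0 ?powR_ge0 ?expR_ge0.
- apply/measurable_funTS/measurable_EFinP; apply: measurable_funM.
    exact: measurable_powR.
  exact: (measurableT_comp (@measurable_expR R) (@oppr_measurable R setT)).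
rewrite [RHS]integral_mkcond; apply: eq_integral => s _; rewrite patchE.
rewrite mem_setE in_itv/= andbT; case: ifPn => s0; last first.
  rewrite integral0_eq// => t _; rewrite /f/= indicE mem_setE in_itv/= andbT.
  case: (boolP (0 < t)%R) => t0; last by rewrite mul0r.
  have -> : (\1_above (t, s) : R) = 0%R; last by rewrite mul0r mulr0.
  rewrite aboveE ltNge (@le_trans _ _ 0%R)//; first by rewrite leNgt.
  by rewrite mulr_ge0 ?powR_ge0// ltW.
transitivity (\int[leb]_(t in `]0%R, ((s / c) `^ alpha)%R[) (expR (- s))%:E).
  rewrite [RHS]integral_mkcond; apply: eq_integral => t _; rewrite patchE /f/=.
  rewrite aboveE indicE !mem_setE !in_itv/= andbT.
  case: (boolP (0 < t)%R) => t0/=; last by rewrite mul0r.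
  have -> : (c * t `^ alpha^-1 < s)%R = (t < (s / c) `^ alpha)%R.
    rewrite mulrC -ltr_pdivlMr//; have sc0 := divr_gt0 s0 c0.
    by rewrite -ltr_powR_inv// ltW.
  by case: ifPn; rewrite ?mul1r ?mul0r.
rewrite integral_cst//= lebesgue_measure_itv/= lte_fin powR_gt0 ?divr_gt0//.
rewrite -EFinB subr0 -!EFinM; congr EFin.
have -> : (1 + alpha - 1)%R = alpha by rewrite addrC addKr.
rewrite powRM ?invr_ge0 ?(ltW s0) ?(ltW c0)//.
rewrite -[in LHS](powR_inv1 (ltW c0)) -powRrM mulN1r.
by ring.
Qed.

(** From [integral_expR_powR] with [c = 1], because [t - 1 <= t ^ (1 / alpha)]. *)
Lemma Gamma_lty (alpha : R) : (0 < alpha <= 1)%R -> Gamma (1 + alpha) < +oo.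
Proof.
move=> /andP[a0 a1].
have := integral_expR_powR a0 (@ltr01 R); rewrite powR1 mul1e => <-.
have mexpN : measurable_fun setT (fun t : R => expR (- t)).
  exact: (measurableT_comp (@measurable_expR R) (@oppr_measurable R setT)).
apply: (@le_lt_trans _ _ (\int[leb]_(t in `]0%R, +oo[) ((expR 1)%:E * (expR (- t))%:E))).
  apply: ge0_le_integral => //.
  - apply/measurable_funTS/measurable_EFinP.
    have mp : measurable_fun setT (fun t : R => 1 * t `^ alpha^-1)%R.
      by apply: measurable_funM => //; exact: (@measurable_powR R alpha^-1).
    exact: (measurableT_comp mexpN mp).
  - by apply/measurable_funTS/measurable_EFinP; apply: measurable_funM.
  move=> t /=; rewrite in_itv/= andbT => t0.
  rewrite -EFinM lee_fin -expRD ler_expR mul1r lerNl opprB lerBlDr.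
  have [t1|t1] := leP (1%R : R) (t : R).
    rewrite ler_wpDr// le1r_powR// -[1%R]invr1 lef_pV2 ?posrE//.
  by apply: (le_trans (ltW t1)); rewrite lerDr powR_ge0.
rewrite ge0_integralZl//.
  by rewrite integral_expR_tail -EFinM ltry.
by apply/measurable_funTS/measurable_EFinP.
Qed.

Lemma Gamma_ge0 (s : R) : 0 <= Gamma s.
Proof.
by apply: integral_ge0 => t _; rewrite lee_fin mulr_ge0 ?powR_ge0 ?expR_ge0.
Qed.

End gamma_integral.

Section exponential_decay.
Context (R : realType) (alpha : R).
Hypothesis alpha_gt0 : (0 < alpha)%R.
Variable f : R -> R.
Hypothesis mf : measurable_fun setT f.
Hypothesis f_ge0 : forall t, (0 <= f t)%R.
Local Notation leb := (@lebesgue_measure R).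

Let decay (c t : R) : R := expR (- (c * t `^ alpha^-1)).

Let mdecay c : measurable_fun setT (decay c).
Proof.
have mp : measurable_fun setT (fun t : R => c * t `^ alpha^-1)%R.
  by apply: measurable_funM => //; exact: (@measurable_powR R alpha^-1).
have mexpN : measurable_fun setT (fun t : R => expR (- t)).
  exact: (measurableT_comp (@measurable_expR R) (@oppr_measurable R setT)).
exact: (measurableT_comp mexpN mp).
Qed.

Let mfX n : measurable_fun setT (fun t => (f t ^+ n)%:E).
Proof. by apply/measurable_EFinP; exact: measurable_funX. Qed.

Let decayX c t n : (decay c t ^+ n)%R = decay (n%:R * c) t.
Proof. by rewrite /decay -expRM_natl mulrN mulrA. Qed.

Let decay_scale c n : (0 < c)%R ->
  \int[leb]_(t in `]0%R, +oo[) (decay (n.+1%:R * c) t)%:E =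
  (n.+1%:R `^ (- alpha) * c `^ (- alpha))%:E * Gamma (1 + alpha).
Proof.
by move=> c0; rewrite integral_expR_powR ?mulr_gt0// powRM// ltW.
Qed.

Lemma integral_pow_le_decay c n : (0 < c)%R ->
  (forall t, (0 < t)%R -> (f t <= expR (- (c * t `^ alpha^-1)))%R) ->
  \int[leb]_(t in `]0%R, +oo[) (f t ^+ n.+1)%:E <=
  (n.+1%:R `^ (- alpha) * c `^ (- alpha))%:E * Gamma (1 + alpha).
Proof.
move=> c0 fc; rewrite -decay_scale//; apply: ge0_le_integral => //.
- by move=> t _; rewrite lee_fin exprn_ge0.
- by apply: measurable_funTS; exact: mfX.
- by apply/measurable_funTS/measurable_EFinP; exact: mdecay.
move=> t /=; rewrite in_itv/= andbT => t0; rewrite lee_fin -decayX.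
by rewrite lerXn2r ?nnegrE ?expR_ge0//; exact: fc.
Qed.

(** Only the behaviour of [f] near [0] determines the constant: for [t >= s], all but
one factor of the power are at most [expR (- (c1 * s ^ (1 / alpha)))], which
contributes a term exponentially small in [n]. *)
Lemma integral_pow_le_local_decay c c1 s n : (0 < c)%R -> (0 < c1)%R -> (0 < s)%R ->
  (forall t, (0 < t)%R -> (f t <= expR (- (c1 * t `^ alpha^-1)))%R) ->
  (forall t, (0 < t < s)%R -> (f t <= expR (- (c * t `^ alpha^-1)))%R) ->
  \int[leb]_(t in `]0%R, +oo[) (f t ^+ n.+1)%:E <=
  (n.+1%:R `^ (- alpha) * c `^ (- alpha))%:E * Gamma (1 + alpha) +
  (expR (- (c1 * s `^ alpha^-1)) ^+ n * c1 `^ (- alpha))%:E * Gamma (1 + alpha).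
Proof.
move=> c0 c10 s0 fc1 fc; rewrite -decay_scale// EFinM -muleA -integral_expR_powR//.
rewrite -ge0_integralZl//; first last.
- by apply/measurable_funTS/measurable_EFinP; exact: (mdecay c1).
rewrite -ge0_integralD//; first last.
- by apply: emeasurable_funM => //; apply/measurable_funTS/measurable_EFinP; exact: (mdecay c1).
- by apply/measurable_funTS/measurable_EFinP; exact: mdecay.
- by move=> t _; rewrite lee_fin expR_ge0.
apply: ge0_le_integral => //.
- by move=> t _; rewrite lee_fin exprn_ge0.
- by apply: measurable_funTS; exact: mfX.
- apply: emeasurable_funD; first by apply/measurable_funTS/measurable_EFinP; exact: mdecay.
  by apply: emeasurable_funM => //; apply/measurable_funTS/measurable_EFinP; exact: (mdecay c1).
move=> t /=; rewrite in_itv/= andbT => t0; rewrite -EFinM -EFinD lee_fin.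
have [ts|st] := ltP t s.
  rewrite (@le_trans _ _ (decay (n.+1%:R * c) t))//.
    by rewrite -decayX lerXn2r ?nnegrE ?expR_ge0//; apply: fc; rewrite t0.
  by rewrite lerDl mulr_ge0 ?exprn_ge0 ?expR_ge0.
rewrite (@le_trans _ _ (expR (- (c1 * s `^ alpha^-1)) ^+ n * decay c1 t)%R)//; last first.
  by rewrite lerDr expR_ge0.
rewrite exprSr ler_pM ?exprn_ge0//; last exact: fc1.
rewrite lerXn2r ?nnegrE ?expR_ge0//; apply: (le_trans (fc1 _ t0)).
rewrite ler_expR lerN2 ler_wpM2l ?(ltW c10)// ge0_ler_powR ?invr_ge0 ?nnegrE ?(ltW alpha_gt0)//.
  exact: ltW.
exact: ltW.
Qed.

End exponential_decay.

(** * The density and its moments *)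

Section weighted_am_gm.
Context (R : realType).
Implicit Types a x : R.

(** With [y] the right-hand side, add up [ln z <= z - 1] at [z = x / y] and at
[z = 1 / y] with weights [a] and [1 - a]; one of the two is strict as [x != 1]. *)
Lemma powR_lt_tangent a x : (0 < a < 1)%R -> (0 <= x)%R -> x != 1%R ->
  (x `^ a < (1 - a) + a * x)%R.
Proof.
move=> /andP[a0 a1]; rewrite le_eqVlt => /predU1P[<- _|x0 x1].
  by rewrite powR0 ?gt_eqF// mulr0 addr0 subr_gt0.
set y := ((1 - a) + a * x)%R.
have y0 : (0 < y)%R by rewrite addr_gt0 ?mulr_gt0// subr_gt0.
have ln_le (z : R) : (0 < z)%R -> (ln z <= z - 1)%R.
  by move=> z0; rewrite lerBrDl; have := expR_ge1Dx (ln z); rewrite lnK.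
have ln_lt (z : R) : (0 < z)%R -> z != 1%R -> (ln z < z - 1)%R.
  move=> z0 z1; have lnz0 : ln z != 0%R.
    by apply: contra z1 => /eqP lnz; rewrite -[z]lnK ?posrE// lnz expR0.
  by rewrite ltrBrDl; have := expR_gt1Dx lnz0; rewrite lnK.
have a10 : (0 < 1 - a)%R by rewrite subr_gt0.
have yi0 : (0 < y^-1)%R by rewrite invr_gt0.
have xy0 : (0 < x / y)%R by rewrite divr_gt0.
have tangent0 : (a * (x / y - 1) + (1 - a) * (y^-1 - 1) = 0)%R.
  by rewrite /y; field; rewrite -/y lt0r_neq0.
have : (a * ln (x / y) + (1 - a) * ln y^-1 < 0)%R.
  rewrite -tangent0; have [y1|y1] := eqVneq y 1%R.
    by rewrite ltr_leD ?ltr_pM2l ?ler_pM2l ?ln_lt ?ln_le// y1 divr1.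
  rewrite ler_ltD ?ltr_pM2l ?ler_pM2l ?ln_lt ?ln_le//.
  by rewrite -[1%R]invr1 (inj_eq invr_inj).
rewrite lnM ?posrE// lnV ?posrE// => lt0.
have lt_ln : (a * ln x < ln y)%R by lra.
by rewrite /powR gt_eqF// -[ltRHS]lnK ?posrE// ltr_expR.
Qed.

Lemma powR_le_tangent a x : (0 < a < 1)%R -> (0 <= x)%R ->
  (x `^ a <= (1 - a) + a * x)%R.
Proof.
move=> a01 x0; have [->|x1] := eqVneq x 1%R; first by rewrite powR1 mulr1 subrK.
by apply: ltW; exact: powR_lt_tangent.
Qed.

End weighted_am_gm.

Section density.
Context (R : realType) d (T : measurableType d) (mu : probability T R).
Variable nu : {finite_measure set T -> \bar R}.
Hypothesis nu_mu : nu `<< mu.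
Hypothesis density_bounded : ess_sup mu (abse \o density nu mu) < +oo.

Lemma density_momentE (dO : measure_display) (O : measurableType dO)
  (P : probability O R) (X : {RV P >-> T}) (h : T -> R) (a : R) :
  measurable_fun setT h ->
  ae_eq (distribution P X) setT (density nu (distribution P X)) (EFin \o h) ->
  measurable_fun setT (density nu (distribution P X)) ->
  (forall x, density nu (distribution P X) x \is a fin_num) ->
  density_moment X nu a = \int[distribution P X]_x (h x `^ a)%:E.
Proof.
move=> mh fh mf ffin; rewrite /density_moment.
pose g x := (fine (density nu (distribution P X) x) `^ a)%:E : \bar R.
have mg : measurable_fun setT g.
  have mff := measurableT_comp (fine_measurable (@measurableT _ (\bar R))) mf.
  by apply/measurable_EFinP; exact: (measurableT_comp (@measurable_powR R a) mff).
transitivity (\int[P]_w g (X w)).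
  by apply: eq_integral => w _; rewrite -[density _ _ _]fineK// poweR_EFin.
have -> : \int[P]_w g (X w) = \int[distribution P X]_x g x.
  by rewrite ge0_integral_distribution// => x; rewrite lee_fin powR_ge0.
apply: ge0_ae_eq_integral => //.
- by apply/measurable_EFinP; exact: (measurableT_comp (@measurable_powR R a) mh).
- by move=> x _; rewrite lee_fin powR_ge0.
- by move=> x _; rewrite lee_fin powR_ge0.
by apply: filterS fh => x /(_ Logic.I)/= fx _; rewrite /g fx.
Qed.

(** Truncating a nonnegative version of the derivative at a bound of its
essential supremum makes the bounds hold everywhere. *)
Lemma bounded_density : exists h : T -> R, exists2 H : R, (0 < H)%R &
  [/\ measurable_fun setT h, forall x, (0 <= h x <= H)%R,
    forall B, measurable B -> nu B = \int[mu]_(x in B) (h x)%:E &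
    ae_eq mu setT (density nu mu) (EFin \o h)].
Proof.
pose f := Radon_Nikodym_SigmaFinite.f nu mu.
have f0 x : 0 <= f x by exact: Radon_Nikodym_SigmaFinite.f_ge0.
have ffin x : f x \is a fin_num by exact: Radon_Nikodym_SigmaFinite.f_fin_num.
have mf : measurable_fun setT f.
  exact: measurable_int (Radon_Nikodym_SigmaFinite.f_integrable nu_mu).
have fE := ae_eq_Radon_Nikodym_SigmaFinite nu_mu measurableT.
pose s := ess_sup mu (abse \o density nu mu).
pose H := Num.max 1%R (fine s).
have sH : s <= H%:E.
  rewrite /H /s; move: density_bounded; case: ess_sup => [r _|//|_]/=; last exact: leNye.
  by rewrite lee_fin le_max lexx orbT.
have H0 : (0 < H)%R by rewrite lt_max ltr01.
exists (fun x => Num.min (fine (f x)) H), H => //.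
have mh : measurable_fun setT (fun x => Num.min (fine (f x)) H).
  apply: measurable_minr => //.
  exact: (measurableT_comp (fine_measurable measurableT)).
have fh : ae_eq mu setT f (EFin \o (fun x => Num.min (fine (f x)) H)).
  have := ess_sup_ge mu (abse \o density nu mu).
  move: fE; apply: filterS2 => x fd ds _ /=.
  have {ds} := le_trans ds sH; rewrite /= /density -(fd I) -/(f x).
  rewrite -[f x]fineK// abse_EFin lee_fin => fH.
  by congr EFin; apply/esym/min_idPl; apply: le_trans fH; exact: ler_norm.
split => //.
- by move=> x; rewrite le_min fine_ge0//= ge_min lexx orbT ltW.
- move=> B mB; rewrite (Radon_Nikodym_SigmaFinite.f_integral nu_mu mB).
  apply: ge0_ae_eq_integral => //.
  - exact: measurable_funTS.
  - exact/measurable_funTS/measurable_EFinP.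
  - by move=> x _; rewrite lee_fin le_min fine_ge0//= ltW.
  by apply: filterS fh => x + _; apply.
- by move: fE fh; apply: filterS2 => x fd fh _; exact: etrans (esym (fd I)) (fh I).
Qed.

(** The gap in the tangent inequality has integral one minus the moment; if this
vanishes, then [h = 1] almost everywhere. *)
Lemma integral_powR_density (h : T -> R) (a : R) : (0 < a < 1)%R ->
  measurable_fun setT h -> (forall x, 0 <= h x)%R -> \int[mu]_x (h x)%:E = 1 ->
  \int[mu]_x (h x `^ a)%:E <= 1 /\
  (~ ae_eq mu setT (EFin \o h) (cst 1) -> \int[mu]_x (h x `^ a)%:E < 1).
Proof.
move=> a01 mh h0 inth; have /andP[a0 a1] := a01.
pose gap x := ((1 - a) + a * h x - h x `^ a)%R.
have gap0 x : (0 <= gap x)%R by rewrite subr_ge0 powR_le_tangent.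
have mha : measurable_fun setT (fun x => h x `^ a)%R.
  exact: (measurableT_comp (@measurable_powR R a) mh).
have mgap : measurable_fun setT gap.
  apply: measurable_funB => //; apply: measurable_funD => //.
  exact: measurable_funM.
have mhaE : measurable_fun setT (fun x => (h x `^ a)%:E) by apply/measurable_EFinP.
have mgapE : measurable_fun setT (fun x => (gap x)%:E) by apply/measurable_EFinP.
have mhE : measurable_fun setT (fun x => (h x)%:E) by apply/measurable_EFinP.
have sum1 : \int[mu]_x (h x `^ a)%:E + \int[mu]_x (gap x)%:E = 1.
  rewrite -ge0_integralD//.
  under eq_integral do rewrite -EFinD addrC subrK EFinD EFinM.
  rewrite ge0_integralD//.
  - rewrite integral_cst//= probability_setT mule1 ge0_integralZl ?lee_fin ?ltW//.
    by rewrite inth mule1 -EFinD subrK.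
  - by move=> x _; rewrite lee_fin.
  - by move=> x _; rewrite lee_fin subr_ge0 ltW.
  - by move=> x _; rewrite -EFinM lee_fin mulr_ge0// ltW.
  - by apply/measurable_EFinP; exact: measurable_funM.
  - by move=> x _; rewrite lee_fin powR_ge0.
  - by move=> x _; rewrite lee_fin.
have intgap0 : 0 <= \int[mu]_x (gap x)%:E by apply: integral_ge0 => x _; rewrite lee_fin.
have le1 : \int[mu]_x (h x `^ a)%:E <= 1 by rewrite -sum1 leeDl.
split => // hN1; rewrite lt_neqAle le1 andbT; apply/negP => /eqP int1.
apply: hN1; have : \int[mu]_x (gap x)%:E = 0.
  apply/eqP; rewrite eq_le intgap0 andbT leNgt; apply/negP => intgap_gt0.
  by have := ltxx (1 : \bar R); rewrite -{2}sum1 int1 lteDl// intgap_gt0.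
have gapabs : \int[mu]_x `|(gap x)%:E| = \int[mu]_x (gap x)%:E.
  by apply: eq_integral => x _; rewrite gee0_abs// lee_fin.
rewrite -gapabs => /ae_eq_integral_abs => /(_ measurableT).
move=> /(_ mgapE); apply: filterS => x /(_ Logic.I)/= [gapx] _.
congr EFin; apply: contrapT => /eqP hx1.
by have := powR_lt_tangent a01 (h0 x) hx1; rewrite -subr_gt0 -/(gap x) gapx ltxx.
Qed.

End density.

(** * The sampling density *)

Section power_distortion.
Context (R : realType) d (T : measurableType d) (omega : T -> T -> R) (k : R).
Hypothesis k_gt0 : (0 < k)%R.
Hypothesis omegaP : is_metric omega.
Hypothesis rhoP : distortion_function (fun x y => (omega x y `^ k)%:E).

Lemma powR_distortion_ltE x y r : (0 <= r)%R ->
  ((omega x y `^ k)%:E < (r `^ k)%:E) = (omega x y < r)%R.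
Proof.
move=> r0; rewrite lte_fin.
have x0 : (0 <= omega x y)%R by case: omegaP.
apply/idP/idP => [|xy]; last by apply: gt0_ltr_powR; rewrite ?nnegrE.
apply: contraTT; rewrite -!leNgt => xy.
by rewrite ge0_ler_powR ?nnegrE// ltW.
Qed.

Lemma measurable_metric_ball x r : measurable [set y | (omega x y < r)%R].
Proof.
have omega0 y : (0 <= omega x y)%R by case: omegaP.
have [r0|r0] := ltP r 0%R.
  rewrite (_ : [set y | _] = set0); first exact: measurable0.
  by apply/seteqP; split => // y /=; rewrite ltNge (le_trans (ltW r0)).
have mrho : measurable_fun setT (fun y => (omega x y `^ k)%:E).
  have [_ mrho] := rhoP.
  have mxy : measurable_fun setT (fun y : T => (x, y)) by exact: measurable_fun_pair.
  exact: (measurableT_comp mrho mxy).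
have := measurable_lte measurableT mrho (measurable_cst (r `^ k)%:E).
rewrite setTI; congr measurable; apply/seteqP; split => y /=;
  by rewrite powR_distortion_ltE.
Qed.

End power_distortion.

Section sampling_weight.
Context (R : realType) d (T : measurableType d) (mu : probability T R).
Variables (h : T -> R) (H eps : R) (K : set T).
Hypothesis mh : measurable_fun setT h.
Hypothesis h_itv : forall x, (0 <= h x <= H)%R.
Hypothesis inth : \int[mu]_x (h x)%:E = 1.
Hypothesis eps_itv : (0 < eps < 1)%R.
Hypothesis mK : measurable K.
Hypothesis K_large : mu (~` K) <= (eps ^+ 2 / H)%:E.
Hypothesis H_gt0 : (0 < H)%R.

Definition level (x : T) : nat := Num.truncn (h x / eps).

(** The function [g] described above. Its value off [K] is its minimum, so that near a
point of [K] it never exceeds the value at that point. *)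
Definition level_step (x : T) : R := if x \in K then (eps * (level x).+1%:R)%R else eps.

Definition sampling_mass : R := fine (\int[mu]_x (h x / level_step x)%:E).

Definition sampling_weight (x : T) : R := (h x / level_step x / sampling_mass)%R.

Let eps_gt0 : (0 < eps)%R. Proof. by case/andP: eps_itv. Qed.
Let h_ge0 x : (0 <= h x)%R. Proof. by case/andP: (h_itv x). Qed.
Let h_le x : (h x <= H)%R. Proof. by case/andP: (h_itv x). Qed.

Lemma measurable_level p : measurable [set x | level x = p].
Proof.
have -> : [set x | level x = p] =
    [set x | (p%:R <= h x / eps)%R] `&` [set x | (h x / eps < p.+1%:R)%R].
  apply/seteqP; split => x /=; rewrite /level.
    move=> <-; have : (0 <= h x / eps)%R by rewrite divr_ge0// ltW.
    by move=> /truncn_itv/andP[].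
  move=> [px xp]; apply/eqP; rewrite truncn_eq; first exact/andP.
  by rewrite divr_ge0// ltW.
have mhe : measurable_fun setT (fun x => h x / eps)%R by exact: measurable_funM.
apply: measurableI.
  have := measurable_fun_ler (measurable_cst (p%:R : R)) mhe measurableT.
  by move=> /(_ [set true] Logic.I); rewrite setTI.
have := measurable_fun_ltr mhe (measurable_cst (p.+1%:R : R)) measurableT.
by move=> /(_ [set true] Logic.I); rewrite setTI.
Qed.

Lemma level_step_ge x : (eps <= level_step x)%R.
Proof.
by rewrite /level_step; case: ifP => // _; rewrite ler_peMr ?ler1n// ltW.
Qed.

Let step_gt0 x : (0 < level_step x)%R.
Proof. exact: lt_le_trans (level_step_ge x). Qed.

Lemma level_step_le x : (level_step x <= h x + eps)%R.
Proof.
rewrite /level_step; case: ifP => _; last by rewrite lerDr.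
rewrite -natr1 mulrDr mulr1 lerD2r mulrC -ler_pdivlMr//.
by rewrite truncn_le divr_ge0// ltW.
Qed.

Lemma lt_level_step x : K x -> (h x < level_step x)%R.
Proof.
move=> Kx; rewrite /level_step mem_set// mulrC -ltr_pdivrMr//.
exact: truncnS_gt.
Qed.

Lemma measurable_level_step : measurable_fun setT level_step.
Proof.
apply: measurable_fun_ifT => //.
  apply: (measurable_fun_bool true); rewrite setTI (_ : _ @^-1` _ = K)//.
  by apply/seteqP; split => [x /set_mem|x /mem_set].
apply: measurable_funM => //.
have mtrunc : measurable_fun setT (fun r : R => (Num.truncn r).+1%:R : R).
  by apply: nondecreasing_measurable => // r s rs; rewrite ler_nat ltnS le_truncn.
have mhe : measurable_fun setT (fun x => h x / eps)%R by exact: measurable_funM.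
exact: (measurableT_comp mtrunc mhe).
Qed.

Let mratio : measurable_fun setT (fun x => h x / level_step x)%R.
Proof.
apply: measurable_funM => //.
rewrite (_ : (fun _ => _) = fun x => (level_step x `^ (-1))%R); last first.
  by apply/funext => x; rewrite powR_inv1// ltW.
exact: (measurableT_comp (@measurable_powR R (-1)) measurable_level_step).
Qed.

Let ratio_ge0 x : (0 <= h x / level_step x)%R.
Proof. by rewrite divr_ge0// ltW. Qed.

(** On [K] the ratio is at most [1], off [K] it is at most [H / eps]; this is where
the smallness of the complement of [K] is used. *)
Let ratio_integral_le : \int[mu]_x (h x / level_step x)%:E <= (1 + eps)%:E.
Proof.
pose bound x := ((1 : R) + (H / eps) * \1_(~` K) x)%R.
have mKC : measurable (~` K) by exact: measurableC.
have mbound : measurable_fun setT bound.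
  by apply: measurable_funD => //; apply: measurable_funM.
apply: (@le_trans _ _ (\int[mu]_x (bound x)%:E)).
  apply: ge0_le_integral => //.
  - by move=> x _; rewrite lee_fin.
  - by apply/measurable_EFinP.
  - by apply/measurable_EFinP.
  move=> x _; rewrite lee_fin /bound indicE.
  have [Kx|nKx] := pselect (K x).
    rewrite memNset ?mulr0 ?addr0; last by move=> /(_ Kx).
    by rewrite ler_pdivrMr// mul1r ltW// lt_level_step.
  rewrite mem_set// mulr1 (@le_trans _ _ (H / eps)%R) ?lerDr//.
  by rewrite ler_pM ?invr_ge0 ?(ltW (step_gt0 x))// lef_pV2 ?posrE// level_step_ge.
rewrite /bound; under eq_integral do rewrite EFinD EFinM.
rewrite ge0_integralD//; first last.
- by apply: emeasurable_funM => //; apply/measurable_EFinP.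
- by move=> x _; rewrite -EFinM lee_fin mulr_ge0// divr_ge0// ltW.
rewrite ge0_integralZl//; first last.
- by rewrite lee_fin divr_ge0// ltW.
- by apply/measurable_EFinP.
rewrite integral_cst//= probability_setT mul1e integral_indic// setIT EFinD leeD2l//.
apply: (@le_trans _ _ ((H / eps)%:E * (eps ^+ 2 / H)%:E)).
  by rewrite lee_wpmul2l// lee_fin divr_ge0// ltW.
rewrite -EFinM lee_fin le_eqVlt; apply/orP; left; apply/eqP.
by field; rewrite !lt0r_neq0.
Qed.

Let ratio_integral_gt0 : 0 < \int[mu]_x (h x / level_step x)%:E.
Proof.
have He0 : (0 < (H + eps)^-1)%R by rewrite invr_gt0 addr_gt0.
apply: (@lt_le_trans _ _ (H + eps)^-1%:E); first by rewrite lte_fin.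
rewrite -[leLHS]mule1 -inth -ge0_integralZl//.
- apply: ge0_le_integral => //.
  + by move=> x _; rewrite -EFinM lee_fin mulr_ge0// ltW.
  + by apply: emeasurable_funM => //; apply/measurable_EFinP.
  + by apply/measurable_EFinP.
  move=> x _; rewrite -EFinM lee_fin mulrC ler_wpM2l// lef_pV2 ?posrE//; last exact: addr_gt0.
  by apply: (le_trans (level_step_le x)); rewrite lerD2r.
- by apply/measurable_EFinP.
- by move=> x _; rewrite lee_fin.
- by rewrite lee_fin ltW.
Qed.

Let massE : (sampling_mass)%:E = \int[mu]_x (h x / level_step x)%:E.
Proof.
rewrite /sampling_mass fineK// ge0_fin_numE; last exact: ltW.
exact: le_lt_trans ratio_integral_le (ltry _).
Qed.

Let mass_gt0 : (0 < sampling_mass)%R.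
Proof. by rewrite -lte_fin massE. Qed.

Let mass_le : (sampling_mass <= 1 + eps)%R.
Proof. by rewrite -lee_fin massE. Qed.

Lemma measurable_sampling_weight : measurable_fun setT sampling_weight.
Proof. exact: measurable_funM. Qed.

Lemma sampling_weight_ge0 x : (0 <= sampling_weight x)%R.
Proof. by rewrite divr_ge0// ltW. Qed.

Lemma integral_sampling_weight : \int[mu]_x (sampling_weight x)%:E = 1.
Proof.
rewrite /sampling_weight; under eq_integral do rewrite EFinM muleC.
rewrite ge0_integralZl//.
- by rewrite -massE -EFinM mulVf// lt0r_neq0.
- by apply/measurable_EFinP.
- by move=> x _; rewrite lee_fin.
- by rewrite lee_fin invr_ge0 ltW.
Qed.

Lemma sampling_weight_regular (B : set T) (p gamma : R) : measurable B ->
  (0 < gamma)%R -> (forall y, B y -> (level_step y <= gamma)%R) ->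
  p%:E <= \int[mu]_(y in B) (h y)%:E ->
  (p / ((1 + eps) * gamma))%:E <= \int[mu]_(y in B) (sampling_weight y)%:E.
Proof.
move=> mB gamma0 Bgamma pB; have eps1 : (0 < 1 + eps)%R by rewrite addr_gt0.
have c0 : (0 < ((1 + eps) * gamma)^-1)%R by rewrite invr_gt0 mulr_gt0.
have mhB : measurable_fun B (fun y => (h y)%:E) by apply/measurable_funTS/measurable_EFinP.
rewrite EFinM muleC.
apply: (@le_trans _ _ (((1 + eps) * gamma)^-1%:E * \int[mu]_(y in B) (h y)%:E)).
  by rewrite lee_wpmul2l// lee_fin ltW.
rewrite -ge0_integralZl//; [|by move=> y _; rewrite lee_fin|by rewrite lee_fin ltW].
apply: ge0_le_integral => //.
- by move=> y _; rewrite -EFinM lee_fin mulr_ge0// ltW.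
- exact: emeasurable_funM.
- by apply/measurable_funTS/measurable_EFinP; exact: measurable_sampling_weight.
move=> y By; rewrite -EFinM lee_fin /sampling_weight -mulrA mulrC ler_wpM2l//.
rewrite -invfM lef_pV2 ?posrE ?mulr_gt0// mulrC ler_pM ?(ltW mass_gt0) ?(ltW (step_gt0 y))//.
exact: Bgamma.
Qed.

End sampling_weight.

Lemma integral_affine_le (R : realType) d (T : measurableType d) (mu : probability T R)
  (f : T -> R) (B : set T) (a1 a2 a3 M e : R) :
  measurable_fun setT f -> (forall x, 0 <= f x)%R -> measurable B ->
  (0 <= a1)%R -> (0 <= a2)%R -> (0 <= a3)%R ->
  \int[mu]_x (f x)%:E <= M%:E -> mu B <= e%:E ->
  \int[mu]_x (a1 * f x + a2 * \1_B x + a3)%:E <= (a1 * M + a2 * e + a3)%:E.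
Proof.
move=> mf f0 mB a10 a20 a30 fM Be.
have mfE : measurable_fun setT (fun x => (a1 * f x)%:E).
  by apply/measurable_EFinP; exact: measurable_funM.
have mBE : measurable_fun setT (fun x => (a2 * \1_B x)%:E).
  by apply/measurable_EFinP; exact: measurable_funM.
have mfBE : measurable_fun setT (fun x => (a1 * f x)%:E + (a2 * \1_B x)%:E).
  exact: emeasurable_funD.
under eq_integral do rewrite !EFinD.
rewrite (@ge0_integralD _ _ _ mu setT measurableT _ (fun=> a3%:E))//; first last.
- by move=> x _; rewrite -EFinD lee_fin addr_ge0// mulr_ge0.
rewrite (@ge0_integralD _ _ _ mu setT measurableT _ (fun x => (a2 * \1_B x)%:E))//; first last.
- by move=> x _; rewrite lee_fin mulr_ge0.
- by move=> x _; rewrite lee_fin mulr_ge0.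
rewrite !EFinD !EFinM; apply: leeD; first apply: leeD.
- under eq_integral do rewrite EFinM.
  rewrite ge0_integralZl//; first by rewrite lee_wpmul2l ?lee_fin.
    by apply/measurable_EFinP.
  by move=> x _; rewrite lee_fin.
- under eq_integral do rewrite EFinM.
  rewrite ge0_integralZl//; first by rewrite integral_indic// setIT lee_wpmul2l ?lee_fin.
  by apply/measurable_EFinP.
- by rewrite integral_cst//= probability_setT mule1.
Qed.

Section level_estimate.
Context (R : realType) d (T : measurableType d).
Context dO (O : measurableType dO) (P : probability O R) (X : {RV P >-> T}).
Variables (omega : T -> T -> R) (k m b c0 delta0 D : R).
Hypothesis omegaP : is_metric omega.
Hypothesis k_gt0 : (0 < k)%R.
Hypothesis k_lt_m : (k < m)%R.
Local Notation rho := (fun x y => (omega x y `^ k)%:E).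
Hypothesis rhoP : distortion_function rho.
Variables (h : T -> R) (H : R).
Local Notation mu := (distribution P X).
Hypothesis mh : measurable_fun setT h.
Hypothesis h_itv : forall x, (0 <= h x <= H)%R.
Hypothesis inth : \int[mu]_x (h x)%:E = 1.
Hypothesis H_gt0 : (0 < H)%R.
Hypothesis b_gt0 : (0 < b)%R.
Hypothesis c0_gt0 : (0 < c0)%R.
Hypothesis delta0_gt0 : (0 < delta0)%R.
Hypothesis omega_le : forall x y, (omega x y <= D)%R.
Hypothesis local_regular : forall x (r : R), (0 < r < delta0)%R ->
  (b * r `^ m)%:E <= \int[mu]_(y in [set y | (omega x y < r)%R]) (h y)%:E.
Hypothesis global_regular : forall x (r : R), (0 < r <= D)%R ->
  (c0 * r `^ m)%:E <= \int[mu]_(y in [set y | (omega x y < r)%R]) (h y)%:E.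

Let alpha := (k / m)%R.
Let m_gt0 : (0 < m)%R. Proof. exact: lt_trans k_lt_m. Qed.
Let alpha_gt0 : (0 < alpha)%R. Proof. exact: divr_gt0. Qed.
Let alpha_lt1 : (alpha < 1)%R. Proof. by rewrite ltr_pdivrMr// mul1r. Qed.

(** At the points of [K], the fine estimate with [b] holds at radii below [delta0] and
below the gap [tau], and the coarse estimate with [c0] elsewhere; off [K], the
coarse estimate alone gives an error of the same order in [n], weighted by the small
measure [e]. *)
Lemma quantization_error_le_level (eps tau e M c1 q : R) (K : set T) n :
  (0 < eps < 1)%R -> measurable K -> mu (~` K) <= (eps ^+ 2 / H)%:E ->
  mu (~` K) <= e%:E -> (0 < tau)%R ->
  (forall x y, K x -> K y -> (omega x y < tau)%R -> level h eps x = level h eps y) ->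
  \int[mu]_x ((h x + eps) `^ alpha)%:E <= M%:E ->
  c1 = (c0 / ((1 + eps) * (H + eps)))%R ->
  q = expR (- (c1 * ((Num.min delta0 tau) `^ k) `^ alpha^-1)) ->
  quantization_error X rho n.+1 <=
  (n.+1%:R `^ (- alpha) * fine (Gamma (1 + alpha)) *
     (b `^ (- alpha) * (1 + eps) `^ alpha * M + c1 `^ (- alpha) * e)
   + q ^+ n * c1 `^ (- alpha) * fine (Gamma (1 + alpha)))%:E.
Proof.
move=> eps01 mK K_large Ke tau0 gap hM c1E qE; have /andP[eps0 _] := eps01.
set G := fine _.
have eps10 : (0 < 1 + eps)%R by rewrite addr_gt0.
have He0 : (0 < H + eps)%R by rewrite addr_gt0.
have h0 x : (0 <= h x)%R by case/andP: (h_itv x).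
have hH x : (h x <= H)%R by case/andP: (h_itv x).
have c10 : (0 < c1)%R by rewrite c1E divr_gt0// mulr_gt0.
have GE : G%:E = Gamma (1 + alpha).
  rewrite fineK// ge0_fin_numE ?Gamma_ge0// Gamma_lty// alpha_gt0 ltW//.
have G0 : (0 <= G)%R by rewrite fine_ge0// Gamma_ge0.
pose w := sampling_weight mu h eps K.
have mw : measurable_fun setT w.
  exact: (measurable_sampling_weight mu mh eps01 mK).
have w0 x : (0 <= w x)%R.
  exact: (sampling_weight_ge0 mh h_itv inth eps01 mK K_large H_gt0).
have intw : \int[mu]_x (w x)%:E = 1.
  exact: (integral_sampling_weight mh h_itv inth eps01 mK K_large H_gt0).
have step_gt0 x : (0 < level_step h eps K x)%R.
  by apply: lt_le_trans (level_step_ge h K eps01 x).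
have step_le x : (level_step h eps K x <= h x + eps)%R by exact: (level_step_le K h_itv eps01).
have mball x r : measurable [set y | (omega x y < r)%R].
  exact: (measurable_metric_ball k_gt0 omegaP rhoP).
have ball_rho x t y : (0 < t)%R -> (omega x y < t `^ k^-1)%R -> rho x y <= t%:E.
  move=> t0; rewrite -(powR_distortion_ltE k_gt0 omegaP) ?powR_ge0//.
  by rewrite -powRrM mulVf ?lt0r_neq0// (powRr1 (ltW t0)) => /ltW.
have powE t : ((t `^ k^-1) `^ m = t `^ alpha^-1)%R.
  by rewrite -powRrM /alpha invf_div mulrC.
(* Beyond the diameter nothing can be missed. *)
have coarse x t : (0 < t)%R ->
    (miss rho mu w x t <= expR (- (c1 * t `^ alpha^-1)))%R.
  move=> t0; have [tD|Dt] := leP (t `^ k^-1)%R D; last first.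
    rewrite miss_eq0 ?expR_ge0// => y.
    by apply: ball_rho => //; exact: le_lt_trans Dt.
  apply: (miss_le_expR rhoP mw w0 intw (mball x (t `^ k^-1)%R)).
    by move=> y /=; exact: ball_rho.
  rewrite c1E mulrAC.
  apply: (sampling_weight_regular mh h_itv inth eps01 mK K_large H_gt0) => //.
    by move=> y _; apply: (le_trans (step_le y)); rewrite lerD2r.
  by rewrite -powE; apply: global_regular; rewrite powR_gt0.
pose s := ((Num.min delta0 tau) `^ k)%R.
have min0 : (0 < Num.min delta0 tau)%R by rewrite lt_min delta0_gt0.
have s0 : (0 < s)%R by rewrite powR_gt0.
have fine_miss x t : K x -> (0 < t < s)%R ->
    (miss rho mu w x t <= expR (- (b / ((1 + eps) * level_step h eps K x) * t `^ alpha^-1)))%R.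
  move=> Kx /andP[t0 ts].
  have : (t `^ k^-1 < Num.min delta0 tau)%R.
    by rewrite -ltr_powR_inv// ltW.
  rewrite lt_min => /andP[tdelta ttau].
  apply: (miss_le_expR rhoP mw w0 intw (mball x (t `^ k^-1)%R)).
    by move=> y /=; exact: ball_rho.
  rewrite mulrAC.
  apply: (sampling_weight_regular mh h_itv inth eps01 mK K_large H_gt0) => //.
    (* In the ball, [level_step] equals its value at [x] on [K], and is minimal off [K]. *)
    move=> y /= xy; have [Ky|nKy] := pselect (K y); last first.
      by rewrite {1}/level_step memNset// level_step_ge.
    by rewrite /level_step !mem_set// (gap x y)// (lt_trans xy).
  by rewrite -powE; apply: local_regular; rewrite powR_gt0.
have mmiss x : measurable_fun setT (miss rho mu w x).
  have mxt : measurable_fun setT (fun t : measurableTypeR R => (x, t)).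
    exact: measurable_fun_pair.
  exact: (measurableT_comp (measurable_miss rhoP mu mw w0) mxt).
have miss0 x t : (0 <= miss rho mu w x t)%R by exact: miss_ge0.
have mhe : measurable_fun setT (fun x => (h x + eps) `^ alpha)%R.
  have mhe : measurable_fun setT (fun x => h x + eps)%R by exact: measurable_funD.
  exact: (measurableT_comp (@measurable_powR R alpha) mhe).
have mKC : measurable (~` K) by exact: measurableC.
pose a1 := (n.+1%:R `^ (- alpha) * G * (b `^ (- alpha) * (1 + eps) `^ alpha))%R.
pose a2 := (n.+1%:R `^ (- alpha) * G * c1 `^ (- alpha))%R.
pose a3 := (q ^+ n * c1 `^ (- alpha) * G)%R.
have a10 : (0 <= a1)%R by rewrite !mulr_ge0 ?powR_ge0.
have a20 : (0 <= a2)%R by rewrite !mulr_ge0 ?powR_ge0.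
have a30 : (0 <= a3)%R by rewrite !mulr_ge0 ?powR_ge0 ?exprn_ge0// qE expR_ge0.
rewrite mulrDr !mulrA -/a2 -/a3 -[X in (X * M)%R]mulrA -/a1.
apply: le_trans (integral_affine_le mhe (fun=> powR_ge0 _ _) mKC a10 a20 a30 hM Ke).
apply: (quantization_error_le_miss X rhoP mw w0 intw).
  apply/measurable_EFinP; apply: measurable_funD => //; apply: measurable_funD.
    exact: measurable_funM.
  by apply: measurable_funM => //; exact: measurable_indic.
move=> x; rewrite indicE; have [Kx|nKx] := pselect (K x); last first.
  apply: le_trans (integral_pow_le_decay alpha_gt0 (mmiss x) (miss0 x) n c10 (coarse x)) _.
  rewrite mem_set// -GE -EFinM lee_fin /a2 mulr1 mulrAC.
  by rewrite -addrA addrCA lerDl addr_ge0// mulr_ge0 ?powR_ge0.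
have cx0 : (0 < b / ((1 + eps) * level_step h eps K x))%R by rewrite divr_gt0// mulr_gt0.
apply: le_trans (integral_pow_le_local_decay alpha_gt0 (mmiss x) (miss0 x) n cx0 c10 s0
  (coarse x) (fine_miss x ^~ Kx)) _.
rewrite -qE.
rewrite memNset; last by move=> /(_ Kx).
rewrite mulr0 addr0 -GE -!EFinM -EFinD lee_fin lerD// /a1.
rewrite [(b / _)%R]mulrC powRM ?invr_ge0 ?mulr_ge0 ?(ltW b_gt0) ?(ltW eps10) ?(ltW (step_gt0 x))//.
rewrite -[(_ * level_step _ _ _ _)^-1%R]powR_inv1 ?mulr_ge0 ?(ltW eps10) ?(ltW (step_gt0 x))//.
rewrite -powRrM mulrNN mul1r powRM ?(ltW eps10) ?(ltW (step_gt0 x))//.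
have step_alpha : (level_step h eps K x `^ alpha <= (h x + eps) `^ alpha)%R.
  by rewrite ge0_ler_powR ?nnegrE ?(ltW alpha_gt0) ?(ltW (step_gt0 x))// addr_ge0// ltW.
have -> : (n.+1%:R `^ (- alpha) * ((1 + eps) `^ alpha * level_step h eps K x `^ alpha *
    b `^ (- alpha)) * G = n.+1%:R `^ (- alpha) * G * (b `^ (- alpha) * (1 + eps) `^ alpha) *
    level_step h eps K x `^ alpha)%R by ring.
by rewrite ler_wpM2l.
Qed.

End level_estimate.

(** * The limit *)

Lemma limn_esup_le_near (R : realType) (u : (\bar R)^nat) (x : \bar R) :
  (\forall n \near \oo, u n <= x) -> limn_esup u <= x.
Proof.
move=> ux; apply: (@le_trans _ _ (ereal_sup (u @` [set n | u n <= x]))).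
  by apply: ereal_inf_lbound; exists [set n | u n <= x].
by apply: ge_ereal_sup => _ [n nx <-].
Qed.

Lemma limn_esup_le_approx (R : realType) (u : (\bar R)^nat) (l : R) :
  (forall e, (0 < e)%R -> exists C, forall n, u n.+1 <= (l + e + C / n.+1%:R)%:E) ->
  limn_esup u <= l%:E.
Proof.
move=> ul; apply/lee_addgt0Pr => e e0.
have e20 : (0 < e / 2)%R by rewrite divr_gt0.
have [C uC] := ul _ e20; apply: limn_esup_le_near.
near=> n; have n0 : (0 < n)%N by near: n; exact: nbhs_infty_gt.
rewrite -(prednK n0); apply: (le_trans (uC _)); rewrite -EFinD lee_fin -addrA lerD2l.
rewrite [leRHS]splitr lerD2l ler_pdivrMr ?ltr0n// prednK// -ler_pdivrMl//.
near: n; exact: nbhs_infty_ger.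
Unshelve. all: end_near. Qed.

Lemma powR_subadditive (R : realType) (a x y : R) : (0 < a <= 1)%R ->
  (0 <= x)%R -> (0 <= y)%R -> ((x + y) `^ a <= x `^ a + y `^ a)%R.
Proof.
move=> /andP[a0 a1]; rewrite le_eqVlt => /predU1P[<- y0|x0].
  by rewrite add0r lerDr powR_ge0.
rewrite le_eqVlt => /predU1P[<-|y0]; first by rewrite addr0 lerDl powR_ge0.
have s0 : (0 < x + y)%R by rewrite addr_gt0.
have part z : (0 < z)%R -> (z <= x + y)%R -> (z / (x + y) * (x + y) `^ a <= z `^ a)%R.
  move=> z0 zs; have zs0 : (0 < z / (x + y))%R by rewrite divr_gt0.
  rewrite -[z in leRHS](divfK (lt0r_neq0 s0)) powRM ?(ltW zs0) ?(ltW s0)//.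
  rewrite ler_wpM2r ?powR_ge0// ger1_powR// zs0 ler_pdivrMr// mul1r//.
apply: (le_trans _ (lerD (part x x0 _) (part y y0 _))); rewrite ?lerDl ?lerDr ?(ltW x0) ?(ltW y0)//.
by rewrite -mulrDl -mulrDl divff ?mul1r// lt0r_neq0.
Qed.

(** Since [expR (n * c) = expR (n * c / 2) ^ 2] is at least [(1 + n * c / 2) ^ 2], hence
at least the square of [n.+1 * Num.min 1 (c / 2)]. *)
Lemma exp_tail_le (R : realType) (c : R) n : (0 < c)%R ->
  (n.+1%:R * expR (- c) ^+ n <= (Num.min 1 (c / 2)) ^- 2 / n.+1%:R)%R.
Proof.
move=> c0; set t := Num.min _ _.
have t0 : (0 < t)%R by rewrite lt_min ltr01 divr_gt0.
rewrite ler_pdivlMr ?ltr0n// -expRM_natl mulrN expRN.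
rewrite mulrAC ler_pdivrMr ?expR_gt0//.
rewrite -ler_pdivrMl ?invr_gt0 ?exprn_gt0// invrK -expr2 -exprMn.
have -> : (n%:R * c = n%:R * (c / 2) * 2%:R)%R by field.
rewrite expRM_natr lerXn2r ?nnegrE ?expR_ge0 ?mulr_ge0 ?(ltW t0)//.
apply: le_trans (expR_ge1Dx _); rewrite -natr1 mulrDr mulr1 addrC lerD//.
  by rewrite ge_min lexx.
by rewrite mulrC ler_wpM2l// ge_min lexx orbT.
Qed.

Section asymptotic_bound.
Context (R : realType) d (T : measurableType d).
Context dO (O : measurableType dO) (P : probability O R) (X : {RV P >-> T}).
Variables (omega : T -> T -> R) (k m b c0 delta0 D : R).
Hypothesis omegaP : is_metric omega.
Hypothesis k_gt0 : (0 < k)%R.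
Hypothesis k_lt_m : (k < m)%R.
Local Notation rho := (fun x y => (omega x y `^ k)%:E).
Hypothesis rhoP : distortion_function rho.
Variables (h : T -> R) (H : R).
Local Notation mu := (distribution P X).
Hypothesis mh : measurable_fun setT h.
Hypothesis h_itv : forall x, (0 <= h x <= H)%R.
Hypothesis inth : \int[mu]_x (h x)%:E = 1.
Hypothesis H_gt0 : (0 < H)%R.
Hypothesis b_gt0 : (0 < b)%R.
Hypothesis c0_gt0 : (0 < c0)%R.
Hypothesis delta0_gt0 : (0 < delta0)%R.
Hypothesis omega_le : forall x y, (omega x y <= D)%R.
Hypothesis local_regular : forall x (r : R), (0 < r < delta0)%R ->
  (b * r `^ m)%:E <= \int[mu]_(y in [set y | (omega x y < r)%R]) (h y)%:E.
Hypothesis global_regular : forall x (r : R), (0 < r <= D)%R ->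
  (c0 * r `^ m)%:E <= \int[mu]_(y in [set y | (omega x y < r)%R]) (h y)%:E.
Hypothesis gaps : forall eps e : R, (0 < eps < 1)%R -> (0 < e)%R ->
  exists K, [/\ measurable K, mu (~` K) <= e%:E &
    exists2 t : R, (0 < t)%R &
      forall x y, K x -> K y -> (omega x y < t)%R -> level h eps x = level h eps y].

Let alpha := (k / m)%R.
Let m_gt0 : (0 < m)%R. Proof. exact: lt_trans k_lt_m. Qed.
Let alpha_gt0 : (0 < alpha)%R. Proof. exact: divr_gt0. Qed.
Let alpha_lt1 : (alpha < 1)%R. Proof. by rewrite ltr_pdivrMr// mul1r. Qed.

Let h_ge0 x : (0 <= h x)%R. Proof. by case/andP: (h_itv x). Qed.

(** The parameter [eta] measures the error and [eps = eta ^ (1 / alpha)], so that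
[(h + eps) ^ alpha <= h ^ alpha + eta] is affine in [eta]. The constant [c2] bounds
the coarse constant [c1] from below uniformly in [eps]. *)
Lemma limn_esup_quantization_error_le :
  limn_esup (fun n => (n%:R `^ alpha)%:E * quantization_error X rho n) <=
  \int[mu]_x (h x `^ alpha)%:E * Gamma (1 + alpha) * (b `^ (- alpha))%:E.
Proof.
have alpha01 : (0 < alpha < 1)%R by rewrite alpha_gt0.
have [moment_le1 _] := integral_powR_density alpha01 mh h_ge0 inth.
set Om := fine (\int[mu]_x (h x `^ alpha)%:E).
have OmE : Om%:E = \int[mu]_x (h x `^ alpha)%:E.
  rewrite fineK// ge0_fin_numE; first exact: le_lt_trans moment_le1 (ltry _).
  by apply: integral_ge0 => x _; rewrite lee_fin powR_ge0.
have Om0 : (0 <= Om)%R.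
  by rewrite fine_ge0// integral_ge0// => x _; rewrite lee_fin powR_ge0.
set G := fine (Gamma (1 + alpha)).
have GE : G%:E = Gamma (1 + alpha).
  by rewrite fineK// ge0_fin_numE ?Gamma_ge0// Gamma_lty// alpha_gt0 ltW.
have G0 : (0 <= G)%R by rewrite fine_ge0// Gamma_ge0.
rewrite -OmE -GE -!EFinM; apply: limn_esup_le_approx => e e0.
pose c2 := (c0 / (2 * (H + 1)))%R.
have c20 : (0 < c2)%R by rewrite divr_gt0// mulr_gt0// addr_gt0.
pose L := (G * (b `^ (- alpha) * (Om + 2) + c2 `^ (- alpha)))%R.
have L0 : (0 <= L)%R.
  by rewrite mulr_ge0// addr_ge0 ?powR_ge0// mulr_ge0 ?powR_ge0// addr_ge0.
have L10 : (0 < L + 1)%R by rewrite ltr_wpDl.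
pose eta : R := (Num.min (1 / 2) (e / (L + 1)))%R.
have eta0 : (0 < eta)%R by rewrite lt_min !divr_gt0.
have eta1 : (eta < 1)%R by rewrite gt_min; apply/orP; left; lra.
have etaL : (eta * L <= e)%R.
  apply: (@le_trans _ _ (eta * (L + 1))%R); first by rewrite ler_pM2l// lerDl.
  by rewrite -ler_pdivlMr// ge_min lexx orbT.
pose eps := (eta `^ alpha^-1)%R.
have eps0 : (0 < eps)%R by rewrite powR_gt0.
have eps_alpha : (eps `^ alpha = eta)%R.
  by rewrite -powRrM mulVf ?lt0r_neq0// powRr1// ltW.
have eps_eta : (eps <= eta)%R.
  have inv_alpha : (1 <= alpha^-1)%R by rewrite -[leLHS]invr1 lef_pV2 ?posrE// ltW.
  by rewrite ge1r_powR// eta0 ltW.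
have eps1 : (eps < 1)%R by exact: le_lt_trans eta1.
have eps01 : (0 < eps < 1)%R by rewrite eps0.
have eK0 : (0 < Num.min (eps ^+ 2 / H) eta)%R.
  by rewrite lt_min eta0 andbT divr_gt0// exprn_gt0.
have [K [mK KeK [tau tau0 gap]]] := gaps eps01 eK0.
have K1 : mu (~` K) <= (eps ^+ 2 / H)%:E.
  by apply: (le_trans KeK); rewrite lee_fin ge_min lexx.
have K2 : mu (~` K) <= eta%:E.
  by apply: (le_trans KeK); rewrite lee_fin ge_min lexx orbT.
have mha : measurable_fun setT (fun x => h x `^ alpha)%R.
  exact: (measurableT_comp (@measurable_powR R alpha) mh).
have hM : \int[mu]_x ((h x + eps) `^ alpha)%:E <= (Om + eta)%:E.
  have -> : (Om + eta = 1 * Om + 0 * 0 + eta)%R by rewrite mul1r mul0r addr0.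
  apply: le_trans (integral_affine_le (B := set0) mha (fun=> powR_ge0 _ _)
    measurable0 ler01 (lexx 0%R) (ltW eta0) _ _); rewrite ?OmE ?measure0//.
  apply: ge0_le_integral => //.
  - by move=> x _; rewrite lee_fin powR_ge0.
  - apply/measurable_EFinP.
    have mhe : measurable_fun setT (fun x => h x + eps)%R by exact: measurable_funD.
    exact: (measurableT_comp (@measurable_powR R alpha) mhe).
  - apply/measurable_EFinP; apply: measurable_funD => //; apply: measurable_funD => //.
      exact: measurable_funM.
    by apply: measurable_funM.
  move=> x _; rewrite lee_fin mul1r mul0r addr0 -eps_alpha.
  by rewrite powR_subadditive ?(ltW eps0)// alpha_gt0 ltW.
pose c1 := (c0 / ((1 + eps) * (H + eps)))%R.
have c10 : (0 < c1)%R by rewrite divr_gt0// mulr_gt0// addr_gt0.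
pose c := (c1 * ((Num.min delta0 tau) `^ k) `^ alpha^-1)%R.
have c_gt0 : (0 < c)%R by rewrite mulr_gt0// !powR_gt0// lt_min delta0_gt0.
exists ((Num.min 1 (c / 2)) ^- 2 * (c1 `^ (- alpha) * G))%R => n.
have bound := quantization_error_le_level omegaP k_gt0 k_lt_m rhoP mh h_itv inth H_gt0 b_gt0
  c0_gt0 delta0_gt0 omega_le local_regular global_regular n eps01 mK K1 K2 tau0 gap hM
  (erefl c1) (erefl (expR (- c))).
apply: (@le_trans _ _ ((n.+1%:R `^ alpha)%:E * (n.+1%:R `^ (- alpha) * G *
  (b `^ (- alpha) * (1 + eps) `^ alpha * (Om + eta) + c1 `^ (- alpha) * eta) +
   expR (- c) ^+ n * c1 `^ (- alpha) * G)%:E)).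
  by rewrite lee_wpmul2l// lee_fin powR_ge0.
rewrite -EFinM lee_fin mulrDr; apply: lerD.
  have n1 : (n.+1%:R `^ alpha * n.+1%:R `^ (- alpha) = 1 :> R)%R.
    by rewrite powRN mulfV// gt_eqF// powR_gt0.
  rewrite [leLHS]mulrA [X in (X * _ <= _)%R]mulrA n1 mul1r.
  have c12 : (c1 `^ (- alpha) <= c2 `^ (- alpha))%R.
    rewrite !powRN lef_pV2 ?posrE ?powR_gt0//.
    rewrite ge0_ler_powR ?nnegrE ?(ltW alpha_gt0) ?(ltW c10) ?(ltW c20)//.
    rewrite /c1 /c2 ler_pM2l// lef_pV2 ?posrE ?mulr_gt0 ?addr_gt0//.
    by rewrite ler_pM ?addr_ge0 ?ltW// ?lerD2l ?ltW//; lra.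
  have eps1_alpha : ((1 + eps) `^ alpha <= 1 + eta)%R.
    rewrite (@le_trans _ _ (1 + eps)%R) ?lerD2l// ler1_powR ?(ltW alpha_lt1)//.
    by rewrite lerDl ltW.
  apply: (@le_trans _ _ (G * (b `^ (- alpha) * (1 + eta) * (Om + eta) + c2 `^ (- alpha) * eta))%R).
    rewrite ler_wpM2l// lerD//; last by rewrite ler_wpM2r// ltW.
    by rewrite ler_wpM2r ?addr_ge0 ?(ltW eta0)// ler_wpM2l ?powR_ge0.
  apply: (@le_trans _ _ (Om * G * b `^ (- alpha) + eta * L)%R); last by rewrite lerD2l.
  rewrite /L -subr_ge0.
  have -> : (Om * G * b `^ (- alpha) +
    eta * (G * (b `^ (- alpha) * (Om + 2) + c2 `^ (- alpha))) -
    G * (b `^ (- alpha) * (1 + eta) * (Om + eta) + c2 `^ (- alpha) * eta) =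
    G * b `^ (- alpha) * (eta * (1 - eta)))%R by ring.
  by rewrite !mulr_ge0 ?powR_ge0 ?subr_ge0// ltW.
have -> : (n.+1%:R `^ alpha * (expR (- c) ^+ n * c1 `^ (- alpha) * G) =
    n.+1%:R `^ alpha * expR (- c) ^+ n * (c1 `^ (- alpha) * G))%R by rewrite !mulrA.
rewrite [leRHS]mulrAC ler_wpM2r//.
  by rewrite mulr_ge0// powR_ge0.
apply: le_trans (exp_tail_le n c_gt0); rewrite ler_wpM2r ?exprn_ge0 ?expR_ge0//.
by rewrite ler1_powR ?ler1n// ltW.
Qed.

End asymptotic_bound.

(** * The bound for Borel subsets of Euclidean space *)

Section borel_subspace_facts.
Context (R : realType) (n : nat) (A : set 'rV[R]_n) (A0 : A !=set0).
Local Notation T := (borel_subspace A0).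
Let v : T -> 'rV[R]_n := @borel_subspace_val _ A A0.

Lemma measurable_borel_subspace_val (U : set 'rV[R]_n) :
  open U -> measurable (v @^-1` U).
Proof. by move=> oU; apply: sub_sigma_algebra; exists U. Qed.

Lemma borel_subspace_val_inj : injective v.
Proof. exact: val_inj. Qed.

Lemma range_borel_subspace_val : range v = A.
Proof.
apply/seteqP; split => [_ [x _ <-]|x Ax]; first exact: set_valP.
by exists (SigSub (mem_set Ax) : set_type A).
Qed.

(** The trace of the Borel sigma-algebra is generated by the trace of the topology. *)
Lemma borel_subspace_preimage (B : set T) : measurable B ->
  exists2 S, <<s open >> S & B = v @^-1` S.
Proof.
move: B; apply: smallest_sub.
  split.
  - by exists set0; [exact: sigma_algebra0|rewrite preimage_set0].
  - move=> _ [S bS ->]; exists (~` S); last by rewrite setTD preimage_setC.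
    by rewrite -setTD; exact: sigma_algebraCD.
  - move=> F FS; have /choice[S SP] : forall i, exists S, <<s open >> S /\ F i = v @^-1` S.
      by move=> i; have [S ? ?] := FS i; exists S.
    exists (\bigcup_i S i); first by apply: sigma_algebra_bigcup => i; have [] := SP i.
    by rewrite preimage_bigcup; apply: eq_bigcupr => i _; have [] := SP i.
move=> _ [U oU <-]; exists U => //; exact: sub_sigma_algebra.
Qed.

End borel_subspace_facts.

Theorem theorem4p3 (R : realType) (d : nat) (A : set 'rV[R]_d)
  (A_borel : <<s open >> A) (A0 : A !=set0)
  (k : R) (k_gt0 : (0 < k)%R)
  (omega : 'rV[R]_d -> 'rV[R]_d -> R) (omega_metric : is_metric omega)
  (rho := @metric_distortion R 'rV[R]_d A A0 omega k)
  (rho_distortion : distortion_function rho)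
  (dO : measure_display) (O : measurableType dO) (P : probability O R)
  (X : {RV P >-> borel_subspace A0})
  (mu := distribution P X)
  (nu : {finite_measure set (borel_subspace A0) -> \bar R})
  (nu1 : nu [set: borel_subspace A0] = 1)
  (nu_mu : nu `<< mu)
  (density_bounded : ess_sup mu (abse \o density nu mu) < +oo)
  (m b : R) (delta0 : \bar R) (k_lt_m : (k < m)%R)
  (nu_superregular :
    superregular (fun x y => rho x y `^ k^-1%R) nu m b delta0)
  (omega_bounded : delta0 < +oo ->
    ereal_sup [set (omega xy.1 xy.2)%:E | xy in A `*` A] < +oo) :
  let bound :=
    density_moment X nu (k / m) * Gamma (1 + k / m) * (b `^ (- (k / m)))%:E in
  [/\ limn_esup (fun n => (n%:R `^ (k / m))%:E * quantization_error X rho n)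
        <= bound,
      forall alpha : R, (0 < alpha < 1)%R ->
        density_moment X nu alpha <= 1 /\
        (~ (forall B, measurable B -> mu B = nu B) ->
          density_moment X nu alpha < 1) &
      has_quantization_dimension X rho k m%:E ->
        upper_quantization_coefficient X rho k <= bound].
Proof.
move=> bound.
have omegaP : is_metric (fun x y : borel_subspace A0 =>
    omega (borel_subspace_val x) (borel_subspace_val y)).
  have [w0 w1 w2 w3] := omega_metric; split => // x y.
  by rewrite w1; split => [/borel_subspace_val_inj|->].
set om := (fun x y => omega _ _) in omegaP.
have m0 : (0 < m)%R by exact: lt_trans k_lt_m.
have alpha01 : (0 < k / m < 1)%R by rewrite divr_gt0//= ltr_pdivrMr// mul1r.
have [h [H H0 [mh h_itv hE hae]]] := bounded_density nu_mu density_bounded.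
have h0 x : (0 <= h x)%R by case/andP: (h_itv x).
have inth : \int[mu]_x (h x)%:E = 1 by rewrite -hE.
have mf : measurable_fun setT (density nu mu).
  by apply: (@measurable_int _ _ _ mu); exact: Radon_Nikodym_integrable.
have ffin x : density nu mu x \is a fin_num by exact: Radon_Nikodym_fin_num.
have momentE a : density_moment X nu a = \int[mu]_x (h x `^ a)%:E.
  exact: density_momentE.
have [_ b_gt0 delta0_gt0 regular] := nu_superregular.
have om_ge0 x y : (0 <= om x y)%R by case: omegaP.
have ballE x (r : R) : [set y | rho x y `^ k^-1%R < r%:E] = [set y | (om x y < r)%R].
  apply: eq_set => y; have -> : rho x y = (om x y `^ k)%:E by [].
  by rewrite poweR_EFin lte_fin -powRrM mulfV ?lt0r_neq0// powRr1.
have {}regular x r : (0 < r)%R -> r%:E < delta0 ->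
    (b * r `^ m)%:E <= nu [set y | (om x y < r)%R].
  by move=> r0 rdelta; rewrite -ballE; exact: regular.
(* Large balls would have mass greater than [1] if [delta0] were infinite. *)
have delta0_lty : delta0 < +oo.
  rewrite ltey; apply/eqP => delta0E.
  pose r := ((2 / b) `^ m^-1)%R.
  have r0 : (0 < r)%R by rewrite powR_gt0// divr_gt0.
  have := regular point r r0; rewrite delta0E => /(_ (ltry _)).
  rewrite -powRrM mulVf ?lt0r_neq0// powRr1 ?divr_ge0 ?(ltW b_gt0)//.
  rewrite mulrC divfK ?lt0r_neq0// => le2.
  have mball := measurable_metric_ball k_gt0 omegaP rho_distortion point r.
  have : nu [set y | (om point y < r)%R] <= nu setT by apply: le_measure; rewrite ?inE.
  rewrite nu1 => /(le_trans le2); rewrite lee_fin; lra.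
have [D D0 omD] : exists2 D : R, (0 < D)%R & forall x y, (om x y <= D)%R.
  have := omega_bounded delta0_lty; set s := ereal_sup _ => slty.
  exists (Num.max 1 (fine s))%R; first by rewrite lt_max ltr01.
  move=> x y; have xys : (om x y)%:E <= s.
    apply: ereal_sup_ubound; exists (borel_subspace_val x, borel_subspace_val y) => //=.
    by split => /=; exact: set_valP.
  rewrite le_max; apply/orP; right; rewrite -lee_fin fineK//.
  by rewrite fin_real// slty (lt_le_trans (ltNyr _) xys).
have [r r0 rdelta] : exists2 r : R, (0 < r)%R & r%:E < delta0.
  move: delta0_gt0 delta0_lty; case: (delta0) => // s; rewrite !lte_fin => s0 _.
  by exists (s / 2)%R; rewrite ?lte_fin ?divr_gt0//; lra.
have part1 : limn_esup (fun n => (n%:R `^ (k / m))%:E * quantization_error X rho n) <= bound.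
  rewrite /bound momentE.
  pose r1 : R := (Num.min r D)%R.
  have r10 : (0 < r1)%R by rewrite lt_min r0.
  have mball := measurable_metric_ball k_gt0 omegaP rho_distortion.
  apply: (@limn_esup_quantization_error_le _ _ _ _ _ _ X om k m b (b * (r1 / D) `^ m)%R r D
    omegaP k_gt0 k_lt_m rho_distortion h H) => //.
  - by rewrite mulr_gt0// powR_gt0// divr_gt0.
  - move=> x s /andP[s0 sr]; rewrite -hE//; apply: regular => //.
    by apply: lt_trans rdelta; rewrite lte_fin.
  (* Up to the diameter [D], regularity persists with a smaller constant: shrink the
     radius by the factor [r1 / D] to bring it below [r]. *)
  - move=> x s /andP[s0 sD]; rewrite -hE//.
    have s10 : (0 < s * (r1 / D))%R by rewrite mulr_gt0// divr_gt0.
    have s1r : (s * (r1 / D) <= r)%R.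
      rewrite mulrCA (@le_trans _ _ r1)//; last by rewrite ge_min lexx.
      by rewrite ler_piMr ?(ltW r10)// ler_pdivrMr// mul1r.
    apply: (@le_trans _ _ (nu [set y | (om x y < s * (r1 / D))%R])).
      rewrite -mulrA -powRM ?(ltW s0) ?divr_ge0 ?(ltW r10) ?(ltW D0)// [(r1 / D * s)%R]mulrC.
      by apply: regular => //; apply: le_lt_trans rdelta; rewrite lee_fin.
    apply: le_measure; rewrite ?inE// => y /= /lt_le_trans; apply.
    rewrite ler_piMr ?(ltW s0)// ler_pdivrMr// mul1r.
    by rewrite ge_min lexx orbT.
  - move=> eps e eps01 e0.
    have [Dn Ddense] : exists Dn : nat -> borel_subspace A0,
        forall x (s : R), (0 < s)%R -> exists i, (om (Dn i) x < s)%R.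
      apply: (dense_sequence omegaP mball (nu := nu)) => s s0.
      have s10 : (0 < Num.min s r)%R by rewrite lt_min s0.
      exists (b * Num.min s r `^ m)%R; first by rewrite mulr_gt0// powR_gt0.
      move=> x; apply: (@le_trans _ _ (nu [set y | (om x y < Num.min s r)%R])).
        apply: regular => //; apply: le_lt_trans rdelta.
        by rewrite lee_fin ge_min lexx orbT.
      apply: le_measure; rewrite ?inE// => y /= /lt_le_trans; apply.
      by rewrite ge_min lexx.
    apply: (level_gap omegaP mball Ddense) => [p|S mS].
      exact: (measurable_level mh h_itv eps01).
    apply: (@almost_continuous_family _ _ _ _ _ (@borel_subspace_val _ A A0)) => //.
    + exact: measurable_borel_subspace_val.
    + by rewrite range_borel_subspace_val.
    + exact: borel_subspace_preimage.
split; first exact: part1.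
- move=> a a01; rewrite momentE; have [le1 lt1] := integral_powR_density a01 mh h0 inth.
  split => // munu; apply: lt1 => h1; apply: munu => B mB.
  rewrite hE// -[LHS]mul1e -integral_cst//; apply: ge0_ae_eq_integral => //.
  + by apply/measurable_funTS/measurable_EFinP.
  + by move=> x _; rewrite lee_fin.
  + by apply: filterS h1 => x /(_ Logic.I)/= ->.
- by move=> [_ upperE]; rewrite /upper_quantization_coefficient upperE.
Qed.
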